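(* Let $D\subseteq \mathcal M^d$ be a free domain and let $\phi$ be a graded function defined on $D$. Then $\phi$ is a free holomorphic function on $D$ if and only if $\phi$ is locally approximable by free polynomials, i.e. for each $M\in D$ and each $\epsilon>0$ there exist a free neighbourhood $U$ of $M$ (an open set in the free topology containing $M$) and a free polynomial $p$ such that $\sup_{x\in U\cap D}\|\phi(x)-p(x)\|<\epsilon$.
   Context: $\mathcal M_n$ denotes the $n\times n$ complex matrices and $\mathcal M^d=\bigcup_{n\ge1}\mathcal M_n^d$ (disjoint union of the sets of $d$-tuples of $n\times n$ matrices). A graded function on $D\subseteq\mathcal M^d$ maps each $x\in D\cap\mathcal M_n^d$ to an element of $\mathcal M_n$. A free polynomial in $d$ variables is a finite linear combination of words in noncommuting variables $x^1,\dots,x^d$ (empty word $=1$), evaluated on $d$-tuples of matrices in the obvious way. For a matrix $\delta$ of free polynomials, $G_\delta=\{M\in\mathcal M^d:\|\delta(M)\|<1\}$ is a basic free open set; the free topology on $\mathcal M^d$ is the topology having the sets $G_\delta$ as a basis, and a free domain is a set open in this topology. An nc-set is a set $D\subseteq\mathcal M^d$ closed under direct sums $M_1\oplus M_2$ (componentwise) and under unitary conjugation $U^*MU$; an nc-domain is an nc-set with $D\cap\mathcal M_n^d$ open for all $n$ (each $G_\delta$ is an nc-domain). An nc-function on an nc-domain $D$ is a graded function $\phi$ with $\phi(x\oplus y)=\phi(x)\oplus\phi(y)$ for $x,y\in D$, and $\phi(s^{-1}xs)=s^{-1}\phi(x)s$ whenever $s$ is an invertible $n\times n$ matrix and $x,s^{-1}xs\in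 D\cap\mathcal M_n^d$. A free holomorphic function on a free domain $D$ is a function $\phi$ such that every $M\in D$ lies in some basic free open set $G_\delta\subseteq D$ on which $\phi$ is a bounded nc-function. *)

(* Defs.v *)
From HB Require Import structures.
From mathcomp Require Import all_boot all_order all_algebra.
From mathcomp Require Import complex.
From mathcomp Require Import boolp classical_sets reals.
Set Implicit Arguments. Unset Strict Implicit. Unset Printing Implicit Defensive.
Import Order.TTheory GRing.Theory Num.Theory.
Local Open Scope ring_scope.
Local Open Scope classical_set_scope.

Section FreeDefs.
Variable R : realType.
Local Notation C := (R[i]).

Definition vnorm (k : nat) (v : 'cV[C]_k) : R :=
  Num.sqrt (\sum_(i < k) Normc.normc (v i 0) ^+ 2).

Definition opnorm (m k : nat) (A : 'M[C]_(m, k)) : R :=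
  sup [set r | exists v : 'cV[C]_k, vnorm v <= 1 /\ r = vnorm (A *m v)].

(* a point of M_n^d : a d-tuple of n x n matrices (only n >= 1 is used) *)
Definition pt (d n : nat) := 'I_d -> 'M[C]_n.

(* a subset of M^d, given size by size; the size-0 part is never used *)
Definition ncset (d : nat) := forall n : nat, set (pt d n).

(* free polynomial: finite linear combination of words in x^1..x^d *)
Definition fpoly (d : nat) := seq (C * seq 'I_d).

Definition peval (d : nat) (p : fpoly d) (n : nat) (x : pt d n) : 'M[C]_n :=
  \sum_(t <- p) t.1 *: \prod_(k <- t.2) x k.

Definition pmeval (d a b : nat) (delta : 'M[fpoly d]_(a, b)) (n : nat)
    (x : pt d n) : 'M[C]_(\sum_(i < a) n, \sum_(j < b) n) :=
  \mxblock_(i < a, j < b) peval (delta i j) x.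

Definition Gdelta (d a b : nat) (delta : 'M[fpoly d]_(a, b)) : ncset d :=
  fun n x => opnorm (pmeval delta x) < 1.

Definition ncsubset (d : nat) (U V : ncset d) : Prop :=
  forall n, (0 < n)%N -> forall x, U n x -> V n x.

Definition free_open (d : nat) (D : ncset d) : Prop :=
  forall n, (0 < n)%N -> forall M : pt d n, D n M ->
    exists a b (delta : 'M[fpoly d]_(a, b)),
      Gdelta delta M /\ ncsubset (Gdelta delta) D.

Definition graded_fun (d : nat) := forall n : nat, pt d n -> 'M[C]_n.

Definition dsum (d n m : nat) (x : pt d n) (y : pt d m) : pt d (n + m) :=
  fun k => block_mx (x k) 0 0 (y k).

Definition simil (d n : nat) (s : 'M[C]_n) (x : pt d n) : pt d n :=
  fun k => invmx s *m x k *m s.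

Definition nc_fun_on (d : nat) (E : ncset d) (phi : graded_fun d) : Prop :=
  (forall n m, (0 < n)%N -> (0 < m)%N -> forall (x : pt d n) (y : pt d m),
     E n x -> E m y ->
     phi (n + m)%N (dsum x y) = block_mx (phi n x) 0 0 (phi m y)) /\
  (forall n, (0 < n)%N -> forall (s : 'M[C]_n) (x : pt d n),
     s \in unitmx -> E n x -> E n (simil s x) ->
     phi n (simil s x) = invmx s *m phi n x *m s).

Definition bounded_on (d : nat) (E : ncset d) (phi : graded_fun d) : Prop :=
  exists K : R, forall n, (0 < n)%N -> forall x : pt d n, E n x ->
    opnorm (phi n x) <= K.

Definition free_holomorphic (d : nat) (D : ncset d) (phi : graded_fun d) : Prop :=
  forall n, (0 < n)%N -> forall M : pt d n, D n M ->
    exists a b (delta : 'M[fpoly d]_(a, b)),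
      Gdelta delta M /\ ncsubset (Gdelta delta) D /\
      nc_fun_on (Gdelta delta) phi /\ bounded_on (Gdelta delta) phi.

(* locally approximable by free polynomials; "sup_{x in U cap D} ... < eps"
   is written as: some r < eps bounds all the values (the set contains M). *)
Definition locally_approx_poly (d : nat) (D : ncset d) (phi : graded_fun d) : Prop :=
  forall n, (0 < n)%N -> forall M : pt d n, D n M ->
  forall eps : R, 0 < eps ->
    exists (U : ncset d) (p : fpoly d),
      free_open U /\ U n M /\
      exists2 r : R, r < eps &
        forall m, (0 < m)%N -> forall x : pt d m, U m x -> D m x ->
          opnorm (phi m x - peval p x) <= r.

End FreeDefs.

(* Main.v *)
Require Import Defs.
From HB Require Import structures.
From mathcomp Require Import all_boot all_order all_algebra.
From mathcomp Require Import complex spectral sesquilinear.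
From mathcomp Require Import boolp classical_sets reals.
From mathcomp Require Import topology normedtype.
From mathcomp Require Import ring lra.

(** A polynomial that approximates [phi] near a direct sum also approximates it near the
summands, and polynomials respect direct sums and similarities; hence a locally
approximable [phi] is an nc-function near every point.

Conversely let [phi] be an nc-function bounded by [K] on [G_delta], and let
[|delta(x)| <= rho < 1].  Every similarity [s] for which [s X s^-1] stays in [G_delta],
[X] a multiple of [x], gives [|s phi(X) s^-1| <= K].  By Hahn-Banach duality for the cone
generated by the forms [sum_j h_j h_j^* - sum_i (delta h)_i (delta h)_i^*], this
amounts (up to an arbitrarily small error) to an inequality
[K^2 v v^* + sum (delta h)(delta h)^* >= phi(X) v (phi(X) v)^* + sum h h^*].
Factoring it through a scalar contraction [V] (the lurking isometry argument) yields
[(phi(x), h) = V (K, delta(x) h)], and iterating this equation [m] times writes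
[phi(x)] as a polynomial in the entries of [delta(x)] with coefficients bounded by [K], up
to an error of order [rho^m].  The coefficients depend on [x], but the degree and the
bound do not, so compactness, applied to direct sums of finitely many points, provides
one polynomial for all [x]. *)

Set Implicit Arguments. Unset Strict Implicit. Unset Printing Implicit Defensive.
Import Order.TTheory GRing.Theory Num.Theory.
Local Open Scope ring_scope.
Local Open Scope sesquilinear_scope.
Local Notation Re := complex.Re.
Local Notation Im := complex.Im.

(** * Euclidean norm and operator norm *)

Section Euclid.
Variable R : realType.
Local Notation C := (R[i]).
Implicit Types (z : C) (t c : R).

Definition sqn z : R := Re z ^+ 2 + Im z ^+ 2.

Definition nrm2 k (v : 'cV[C]_k) : R := \sum_(i < k) sqn (v i 0).

(** The Euclidean product of [C^k] seen as a real space, that is, the real part of the Hermitian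
    product. *)
Definition rdot k (u v : 'cV[C]_k) : R :=
  \sum_(i < k) (Re (u i 0) * Re (v i 0) + Im (u i 0) * Im (v i 0)).

Lemma sqn_ge0 z : 0 <= sqn z.
Proof. by rewrite addr_ge0 ?sqr_ge0. Qed.

Lemma sqn0 : sqn 0 = 0.
Proof. by rewrite /sqn /= !expr0n addr0. Qed.

Lemma sqnM z1 z2 : sqn (z1 * z2) = sqn z1 * sqn z2.
Proof. by case: z1 z2 => [a b] [a' b']; rewrite /sqn /=; ring. Qed.

Lemma sqnN z : sqn (- z) = sqn z.
Proof. by case: z => a b; rewrite /sqn /=; ring. Qed.

Lemma sqnJ z : sqn (conjc z) = sqn z.
Proof. by case: z => a b; rewrite /sqn /=; ring. Qed.

Lemma sqnR t : sqn t%:C%C = t ^+ 2.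
Proof. by rewrite /sqn /=; ring. Qed.

Lemma sqn_normc z : sqn z = Normc.normc z ^+ 2.
Proof. by case: z => a b; rewrite /sqn /Normc.normc sqr_sqrtr ?addr_ge0 ?sqr_ge0. Qed.

Lemma sqn_eq0 z : sqn z = 0 -> z = 0.
Proof. by rewrite sqn_normc => /eqP; rewrite sqrf_eq0 => /eqP/Normc.eq0_normc. Qed.

Lemma ReD z1 z2 : Re (z1 + z2) = Re z1 + Re z2.
Proof. by case: z1; case: z2. Qed.

Lemma Re_sum I (r : seq I) (P : pred I) (F : I -> C) :
  Re (\sum_(i <- r | P i) F i) = \sum_(i <- r | P i) Re (F i).
Proof. exact: (big_morph _ ReD). Qed.

Lemma ReZ t z : Re (t%:C%C * z) = t * Re z.
Proof. by case: z => a b /=; ring. Qed.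

Lemma ReN z : Re (- z) = - Re z.
Proof. by case: z. Qed.

Lemma ReMn z n : Re (z *+ n) = Re z *+ n.
Proof. by elim: n => [|n IH]; rewrite ?mulr0n // !mulrS ReD IH. Qed.

Lemma nrm2_ge0 k (v : 'cV[C]_k) : 0 <= nrm2 v.
Proof. by apply: sumr_ge0 => i _; apply: sqn_ge0. Qed.
Hint Resolve nrm2_ge0 : core.

Lemma nrm2_0 k : nrm2 (0 : 'cV[C]_k) = 0.
Proof. by rewrite /nrm2 big1 // => i _; rewrite mxE sqn0. Qed.

Lemma nrm2_eq0 k (v : 'cV[C]_k) : nrm2 v = 0 -> v = 0.
Proof.
move=> /eqP; rewrite psumr_eq0; last by move=> i _; apply: sqn_ge0.
move=> /allP h; apply/matrixP=> i j; rewrite ord1 mxE; apply: sqn_eq0.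
by apply/eqP/h; rewrite mem_index_enum.
Qed.

Lemma nrm2Z k z (v : 'cV[C]_k) : nrm2 (z *: v) = sqn z * nrm2 v.
Proof. by rewrite /nrm2 mulr_sumr; apply: eq_bigr => i _; rewrite mxE sqnM. Qed.

Lemma nrm2N k (v : 'cV[C]_k) : nrm2 (- v) = nrm2 v.
Proof. by apply: eq_bigr => i _; rewrite mxE sqnN. Qed.

Lemma nrm2D k (u v : 'cV[C]_k) : nrm2 (u + v) = nrm2 u + 2 * rdot u v + nrm2 v.
Proof.
rewrite /nrm2 /rdot mulr_sumr -!big_split /=; apply: eq_bigr => i _; rewrite mxE.
by case: (u i 0) (v i 0) => [a b] [a' b']; rewrite /sqn /=; ring.
Qed.

Lemma rdotZ k s t (u v : 'cV[C]_k) :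
  rdot (s%:C%C *: u) (t%:C%C *: v) = s * t * rdot u v.
Proof.
rewrite /rdot mulr_sumr; apply: eq_bigr => i _; rewrite !mxE.
by case: (u i 0) (v i 0) => [a b] [a' b']; rewrite /=; ring.
Qed.

Lemma vnormE k (v : 'cV[C]_k) : vnorm v = Num.sqrt (nrm2 v).
Proof. by congr Num.sqrt; apply: eq_bigr => i _; rewrite sqn_normc. Qed.

Lemma vnorm_ge0 k (v : 'cV[C]_k) : 0 <= vnorm v.
Proof. by rewrite vnormE sqrtr_ge0. Qed.
Hint Resolve vnorm_ge0 : core.

Lemma vnorm_sq k (v : 'cV[C]_k) : vnorm v ^+ 2 = nrm2 v.
Proof. by rewrite vnormE sqr_sqrtr. Qed.

Lemma vnorm0 k : vnorm (0 : 'cV[C]_k) = 0.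
Proof. by rewrite vnormE nrm2_0 sqrtr0. Qed.

Lemma vnorm_eq0 k (v : 'cV[C]_k) : vnorm v = 0 -> v = 0.
Proof. by move=> h; apply: nrm2_eq0; rewrite -vnorm_sq h expr0n. Qed.

Lemma normcR t : 0 <= t -> Normc.normc t%:C%C = t.
Proof. by move=> t0; rewrite /= expr0n addr0 sqrtr_sqr ger0_norm. Qed.

Lemma normc_ge0 z : 0 <= Normc.normc z.
Proof. by case: z => a b; rewrite sqrtr_ge0. Qed.

Lemma vnormZ k z (v : 'cV[C]_k) : vnorm (z *: v) = Normc.normc z * vnorm v.
Proof.
by rewrite !vnormE nrm2Z sqn_normc sqrtrM ?sqr_ge0 // sqrtr_sqr ger0_norm ?normc_ge0.
Qed.

Lemma vnormN k (v : 'cV[C]_k) : vnorm (- v) = vnorm v.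
Proof. by rewrite !vnormE nrm2N. Qed.

Lemma rdot_le k (u v : 'cV[C]_k) : rdot u v <= vnorm u * vnorm v.
Proof.
have rdot0 w1 w2 : (w1 == 0) || (w2 == 0) -> rdot w1 w2 = 0 :> R.
  by move=> h; rewrite /rdot big1 // => i _; case/orP: h => /eqP ->; rewrite mxE /=; ring.
have [u0|u0] := eqVneq u 0; first by rewrite rdot0 ?u0 ?eqxx // mulr_ge0.
have [v0|v0] := eqVneq v 0; first by rewrite rdot0 ?v0 ?eqxx ?orbT // mulr_ge0.
have pos w : w != 0 -> 0 < vnorm w :> R.
  by move=> w0; rewrite lt_neqAle vnorm_ge0 andbT eq_sym; apply: contraNneq w0 => /vnorm_eq0 ->.
have pu := pos k u u0; have pv := pos k v v0.
(* Cauchy-Schwarz: the square norm of [|v| u - |u| v] is [2 |u| |v| (|u| |v| - rdot u v)]. *)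
have := nrm2_ge0 ((vnorm v)%:C%C *: u + (- vnorm u)%:C%C *: v).
rewrite nrm2D rdotZ !nrm2Z !sqnR -!vnorm_sq => h.
rewrite -(ler_pM2l (mulr_gt0 pu pv)) -subr_ge0.
rewrite -(pmulr_rge0 _ (ltr0n R 2)) /=; apply: le_trans h _.
by rewrite le_eqVlt; apply/orP; left; apply/eqP; ring.
Qed.

Lemma vnormD k (u v : 'cV[C]_k) : vnorm (u + v) <= vnorm u + vnorm v.
Proof.
rewrite -(ler_pXn2r (ltn0Sn 1)) ?nnegrE ?addr_ge0 //.
by rewrite vnorm_sq nrm2D -!vnorm_sq; have := rdot_le u v; lra.
Qed.

Lemma vnorm_sum k I (r : seq I) (F : I -> 'cV[C]_k) :
  vnorm (\sum_(i <- r) F i) <= \sum_(i <- r) vnorm (F i).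
Proof.
elim/big_ind2: _ => [|u x v y hu hv|//]; first by rewrite vnorm0.
by apply: le_trans (vnormD _ _) _; apply: lerD.
Qed.

Lemma normc_le_vnorm k (v : 'cV[C]_k) i : Normc.normc (v i 0) <= vnorm v.
Proof.
rewrite -(ler_pXn2r (ltn0Sn 1)) ?nnegrE ?normc_ge0 // -sqn_normc vnorm_sq.
by rewrite /nrm2 (bigD1 i) //= lerDl sumr_ge0 // => j _; apply: sqn_ge0.
Qed.

Lemma mulmx_bounded m k (A : 'M[C]_(m, k)) :
  exists2 B, 0 <= B & forall v, vnorm (A *m v) <= B * vnorm v.
Proof.
exists (\sum_j vnorm (col j A)); first by apply: sumr_ge0.
move=> v; have -> : A *m v = \sum_j v j 0 *: col j A.
  apply/matrixP=> i j; rewrite ord1 summxE mxE; apply: eq_bigr => l _.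
  by rewrite !mxE mulrC.
apply: le_trans (vnorm_sum _ _) _; rewrite mulr_suml; apply: ler_sum => j _.
by rewrite vnormZ mulrC ler_wpM2l // normc_le_vnorm.
Qed.

(** A real [sup] carries information only for a nonempty bounded set; the column norms of [A]
    provide the bound. *)
Lemma opnorm_has_sup m k (A : 'M[C]_(m, k)) :
  has_sup [set r | exists v : 'cV[C]_k, vnorm v <= 1 /\ r = vnorm (A *m v)]%classic.
Proof.
split; first by exists (vnorm (A *m 0)), 0; rewrite vnorm0.
have [B B0 hB] := mulmx_bounded A; exists B => _ [v [v1 ->]].
by apply: le_trans (hB v) _; rewrite ler_piMr.
Qed.

Lemma opnorm_ge0 m k (A : 'M[C]_(m, k)) : 0 <= opnorm A.
Proof.
apply: le_trans (ub_le_sup (proj2 (opnorm_has_sup A)) _); last first.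
  by exists 0; rewrite vnorm0; split.
exact: vnorm_ge0.
Qed.
Hint Resolve opnorm_ge0 : core.

Lemma vnorm_mulmx m k (A : 'M[C]_(m, k)) v : vnorm (A *m v) <= opnorm A * vnorm v.
Proof.
have [v0|v0] := eqVneq (vnorm v) 0.
  by rewrite (vnorm_eq0 v0) mulmx0 !vnorm0 mulr0.
have pv : 0 < vnorm v by rewrite lt_neqAle vnorm_ge0 andbT eq_sym.
rewrite mulrC -ler_pdivrMl //.
have -> : (vnorm v)^-1 * vnorm (A *m v) = vnorm (A *m ((vnorm v)^-1%:C%C *: v)).
  by rewrite -scalemxAr vnormZ normcR // invr_ge0.
apply: ub_le_sup (proj2 (opnorm_has_sup A)) _ _; exists ((vnorm v)^-1%:C%C *: v).
by split => //; rewrite vnormZ normcR ?invr_ge0 // mulVf.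
Qed.

Lemma opnorm_le m k (A : 'M[C]_(m, k)) c : 0 <= c ->
  (forall v, vnorm (A *m v) <= c * vnorm v) -> opnorm A <= c.
Proof.
move=> c0 h; apply: ge_sup; first exact: (proj1 (opnorm_has_sup A)).
by move=> _ [v [v1 ->]]; apply: le_trans (h v) _; rewrite ler_piMr.
Qed.

Lemma vnorm_le_nrm2 m k (v : 'cV[C]_m) (w : 'cV[C]_k) c : 0 <= c ->
  (vnorm v <= c * vnorm w) = (nrm2 v <= c ^+ 2 * nrm2 w).
Proof.
move=> c0; rewrite -(ler_pXn2r (ltn0Sn 1)) ?nnegrE ?mulr_ge0 //.
by rewrite exprMn !vnorm_sq.
Qed.

Lemma nrm2_mulmx m k (A : 'M[C]_(m, k)) v c :
  opnorm A <= c -> nrm2 (A *m v) <= c ^+ 2 * nrm2 v.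
Proof.
move=> Ac; have c0 : 0 <= c by apply: le_trans Ac.
rewrite -vnorm_le_nrm2 //; apply: le_trans (vnorm_mulmx _ _) _.
by rewrite ler_wpM2r.
Qed.

Lemma opnorm_le_nrm2 m k (A : 'M[C]_(m, k)) c : 0 <= c ->
  (forall v, nrm2 (A *m v) <= c ^+ 2 * nrm2 v) -> opnorm A <= c.
Proof. by move=> c0 h; apply: opnorm_le => // v; rewrite vnorm_le_nrm2. Qed.

Lemma opnormD m k (A B : 'M[C]_(m, k)) : opnorm (A + B) <= opnorm A + opnorm B.
Proof.
apply: opnorm_le; first exact: addr_ge0.
move=> v; rewrite mulmxDl mulrDl; apply: le_trans (vnormD _ _) _.
by apply: lerD; apply: vnorm_mulmx.
Qed.

Lemma opnormN m k (A : 'M[C]_(m, k)) : opnorm (- A) = opnorm A.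
Proof.
have le B : opnorm (- B) <= opnorm B :> R.
  by apply: opnorm_le => // v; rewrite mulNmx vnormN vnorm_mulmx.
by apply/eqP; rewrite eq_le le -{1}[A]opprK le.
Qed.

Lemma opnormM m k l (A : 'M[C]_(m, k)) (B : 'M[C]_(k, l)) :
  opnorm (A *m B) <= opnorm A * opnorm B.
Proof.
apply: opnorm_le => [|v]; first exact: mulr_ge0.
rewrite -mulmxA -mulrA; apply: le_trans (vnorm_mulmx _ _) _.
by rewrite ler_wpM2l // vnorm_mulmx.
Qed.

Lemma opnormZ m k z (A : 'M[C]_(m, k)) : opnorm (z *: A) <= Normc.normc z * opnorm A.
Proof.
apply: opnorm_le => [|v]; first by rewrite mulr_ge0 ?normc_ge0.
by rewrite -scalemxAl vnormZ -mulrA ler_wpM2l ?normc_ge0 // vnorm_mulmx.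
Qed.

Lemma opnorm_sum m k I (r : seq I) (F : I -> 'M[C]_(m, k)) :
  opnorm (\sum_(i <- r) F i) <= \sum_(i <- r) opnorm (F i).
Proof.
elim/big_ind2: _ => [|A x B y hA hB|//].
  by apply: opnorm_le => // v; rewrite mul0mx mul0r vnorm0.
by apply: le_trans (opnormD _ _) _; apply: lerD.
Qed.

Lemma opnorm_eq0 m k (A : 'M[C]_(m, k)) : opnorm A <= 0 -> A = 0.
Proof.
move=> h; apply/matrixP => i j.
have : col j A = 0.
  apply: vnorm_eq0; apply/eqP; rewrite eq_le vnorm_ge0 andbT colE.
  apply: le_trans (vnorm_mulmx _ _) _.
  by have -> : opnorm A = 0; [apply/eqP; rewrite eq_le h opnorm_ge0 | rewrite mul0r].
by move=> /matrixP/(_ i 0); rewrite !mxE.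
Qed.

End Euclid.
#[local] Hint Extern 0 (is_true (0 <= nrm2 _)) => exact: nrm2_ge0 : core.
#[local] Hint Extern 0 (is_true (0 <= vnorm _)) => exact: vnorm_ge0 : core.
#[local] Hint Extern 0 (is_true (0 <= opnorm _)) => exact: opnorm_ge0 : core.
(** * Free polynomials and basic free open sets *)

Section FreePolynomials.
Variables (R : realType) (d : nat).
Local Notation C := (R[i]).
Implicit Types p q : fpoly R d.

Definition pscale (z : C) p : fpoly R d := [seq (z * t.1, t.2) | t <- p].

Definition pmul p q : fpoly R d := [seq (s.1 * t.1, s.2 ++ t.2) | s <- p, t <- q].

Lemma peval_cons t p n (x : pt R d n) :
  peval (t :: p) x = t.1 *: (\prod_(k <- t.2) x k) + peval p x.
Proof. by rewrite /peval big_cons. Qed.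

Lemma peval_nil n (x : pt R d n) : peval [::] x = 0.
Proof. by rewrite /peval big_nil. Qed.

Lemma peval_cat p q n (x : pt R d n) : peval (p ++ q) x = peval p x + peval q x.
Proof. by rewrite /peval big_cat. Qed.

Lemma peval_scale z p n (x : pt R d n) : peval (pscale z p) x = z *: peval p x.
Proof.
by rewrite /peval big_map scaler_sumr; apply: eq_bigr => t _; rewrite scalerA.
Qed.

Lemma peval_mul p q n (x : pt R d n) : peval (pmul p q) x = peval p x *m peval q x.
Proof.
elim: p => [|s p IH]; first by rewrite /pmul /= peval_nil mul0mx.
rewrite /pmul allpairs_cons peval_cat -/(pmul p q) IH peval_cons mulmxDl; congr (_ + _).
rewrite /peval big_map mulmx_sumr; apply: eq_bigr => t _ /=.
by rewrite big_cat /= -scalemxAl -scalemxAr scalerA.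
Qed.

Lemma peval1 n (x : pt R d n) : peval [:: (1, [::])] x = 1%:M.
Proof. by rewrite peval_cons peval_nil big_nil scale1r addr0. Qed.

(** [J] may be rectangular, so similarities, inclusions of summands and projections onto them are
    all instances. *)
Lemma peval_intertwine p n m (x : pt R d n) (y : pt R d m) (J : 'M[C]_(m, n)) :
  (forall k, y k *m J = J *m x k) -> peval p y *m J = J *m peval p x.
Proof.
move=> yJ; have prodJ w : (\prod_(k <- w) y k) *m J = J *m \prod_(k <- w) x k.
  elim: w => [|k w IH]; first by rewrite !big_nil mul1mx mulmx1.
  by rewrite !big_cons -mulmxA IH !mulmxA yJ.
rewrite /peval mulmx_suml mulmx_sumr; apply: eq_bigr => t _.
by rewrite -scalemxAl prodJ -scalemxAr.
Qed.

Lemma peval_simil p n (s : 'M[C]_n) (x : pt R d n) : s \in unitmx ->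
  peval p (simil s x) = invmx s *m peval p x *m s.
Proof.
move=> su; rewrite -(@peval_intertwine p n n x (simil s x)) ?mulmxKV //.
by move=> k; rewrite /simil mulmxK.
Qed.

Lemma peval_dsum p n m (x : pt R d n) (y : pt R d m) :
  peval p (dsum x y) = block_mx (peval p x) 0 0 (peval p y).
Proof.
have h1 : peval p (dsum x y) *m col_mx 1%:M 0 = col_mx 1%:M 0 *m peval p x.
  apply: peval_intertwine => k.
  by rewrite /dsum mul_block_col mul_col_mx !mulmx1 !mulmx0 !addr0 mul1mx mul0mx.
have h2 : peval p (dsum x y) *m col_mx 0 1%:M = col_mx 0 1%:M *m peval p y.
  apply: peval_intertwine => k.
  by rewrite /dsum mul_block_col mul_col_mx !mulmx1 !mulmx0 !add0r mul1mx mul0mx.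
have -> : peval p (dsum x y) =
    peval p (dsum x y) *m row_mx (col_mx 1%:M 0) (col_mx 0 1%:M).
  by rewrite -block_mxEh -scalar_mx_block mulmx1.
by rewrite mul_mx_row h1 h2 !mul_col_mx !mul0mx !mul1mx block_mxEh.
Qed.

End FreePolynomials.

Section BasicSets.
Variables (R : realType) (d a b : nat) (delta : 'M[fpoly R d]_(a, b)).
Local Notation C := (R[i]).

Definition dapply n (x : pt R d n) (v : 'I_b -> 'cV[C]_n) (i : 'I_a) : 'cV[C]_n :=
  \sum_j peval (delta i j) x *m v j.

(** For [c >= 0] this is [|delta(x)| <= c], stated on families of vectors to avoid the block indices
    of [pmeval]. *)
Definition dle n (x : pt R d n) (c : R) := forall v : 'I_b -> 'cV[C]_n,
  \sum_i nrm2 (dapply x v i) <= c ^+ 2 * \sum_j nrm2 (v j).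

Lemma nrm2_mxcol k n (v : 'I_k -> 'cV[C]_n) :
  nrm2 (\mxcol_(i < k) v i) = \sum_i nrm2 (v i).
Proof.
rewrite /nrm2 sig_big_dep /= (reindex _ tagnat.sig_bij_on) /=.
by apply: eq_bigr => l _; rewrite !mxE.
Qed.

Lemma opnorm_pmeval n (x : pt R d n) (c : R) : 0 <= c ->
  opnorm (pmeval delta x) <= c <-> dle x c.
Proof.
move=> c0; have E v : nrm2 (pmeval delta x *m \mxcol_j v j) =
                      \sum_i nrm2 (dapply x v i).
  by rewrite /pmeval mul_mxblock_mxrow nrm2_mxcol.
split=> [h v|h]; first by rewrite -E -nrm2_mxcol; apply: nrm2_mulmx.
apply: opnorm_le_nrm2 => // v.
by rewrite -[v]submxcolK E nrm2_mxcol; apply: h.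
Qed.

Lemma GdeltaP n (x : pt R d n) :
  Gdelta delta x <-> exists2 c, 0 <= c < 1 & dle x c.
Proof.
split=> [h|[c /andP[c0 c1] h]].
  by exists (opnorm (pmeval delta x)); [rewrite opnorm_ge0|apply/opnorm_pmeval].
by apply: le_lt_trans c1; apply/opnorm_pmeval.
Qed.

(** An isometric intertwiner identifies [x] with the restriction of [y] to an invariant subspace,
    and restriction does not increase norms. *)
Lemma dle_sub n m (x : pt R d n) (y : pt R d m) (J : 'M[C]_(m, n)) c :
  (forall v, nrm2 (J *m v) = nrm2 v) -> (forall k, y k *m J = J *m x k) ->
  dle y c -> dle x c.
Proof.
move=> isoJ yJ h v; have := h (fun j => J *m v j).
have dJ i : dapply y (fun j => J *m v j) i = J *m dapply x v i.
  rewrite /dapply mulmx_sumr; apply: eq_bigr => j _.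
  by rewrite mulmxA (peval_intertwine _ yJ) mulmxA.
by rewrite (eq_bigr _ (fun i _ => congr1 (@nrm2 R m) (dJ i))) !(eq_bigr _ (fun _ _ => isoJ _)).
Qed.

Lemma nrm2_col_mx n m (u : 'cV[C]_n) (v : 'cV[C]_m) :
  nrm2 (col_mx u v) = nrm2 u + nrm2 v.
Proof.
rewrite /nrm2 big_split_ord /=.
by congr (_ + _); apply: eq_bigr => i _; rewrite ?col_mxEu ?col_mxEd.
Qed.

Lemma nrm2_inl n m (v : 'cV[C]_n) : nrm2 (col_mx 1%:M (0 : 'M_(m, n)) *m v) = nrm2 v.
Proof. by rewrite mul_col_mx mul1mx mul0mx nrm2_col_mx nrm2_0 addr0. Qed.

Lemma nrm2_inr n m (v : 'cV[C]_n) : nrm2 (col_mx (0 : 'M_(m, n)) 1%:M *m v) = nrm2 v.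
Proof. by rewrite mul_col_mx mul1mx mul0mx nrm2_col_mx nrm2_0 add0r. Qed.

Lemma block_diag_inl n m (A : 'M[C]_n) (B : 'M[C]_m) :
  block_mx A 0 0 B *m col_mx 1%:M 0 = col_mx 1%:M 0 *m A.
Proof. by rewrite mul_block_col mul_col_mx !mulmx1 !mulmx0 !addr0 mul1mx mul0mx. Qed.

Lemma block_diag_inr n m (A : 'M[C]_n) (B : 'M[C]_m) :
  block_mx A 0 0 B *m col_mx 0 1%:M = col_mx 0 1%:M *m B.
Proof. by rewrite mul_block_col mul_col_mx !mulmx1 !mulmx0 !add0r mul1mx mul0mx. Qed.

Lemma opnorm_sub n m (A : 'M[C]_n) (B : 'M[C]_m) (J : 'M[C]_(m, n)) :
  (forall v, nrm2 (J *m v) = nrm2 v) -> B *m J = J *m A -> opnorm A <= opnorm B.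
Proof.
move=> isoJ BJ; apply: opnorm_le_nrm2 => // v.
by rewrite -isoJ mulmxA -BJ -mulmxA -(isoJ v); apply: nrm2_mulmx.
Qed.

Lemma dle_dsuml n m (x : pt R d n) (y : pt R d m) c : dle (dsum x y) c -> dle x c.
Proof.
by apply: dle_sub => [v|k]; [apply: nrm2_inl | apply: block_diag_inl].
Qed.

Lemma dle_dsumr n m (x : pt R d n) (y : pt R d m) c : dle (dsum x y) c -> dle y c.
Proof.
by apply: dle_sub => [v|k]; [apply: nrm2_inr | apply: block_diag_inr].
Qed.

Lemma dle_dsum n m (x : pt R d n) (y : pt R d m) c :
  dle x c -> dle y c -> dle (dsum x y) c.
Proof.
move=> hx hy v; pose u j := usubmx (v j); pose w j := dsubmx (v j).
have ->: \sum_j nrm2 (v j) = \sum_j nrm2 (u j) + \sum_j nrm2 (w j).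
  by rewrite -big_split /=; apply: eq_bigr => j _; rewrite -nrm2_col_mx vsubmxK.
have ->: \sum_i nrm2 (dapply (dsum x y) v i) =
    \sum_i nrm2 (dapply x u i) + \sum_i nrm2 (dapply y w i).
  rewrite -big_split /=; apply: eq_bigr => i _; rewrite -nrm2_col_mx; congr nrm2.
  rewrite /dapply; elim: (index_enum _) => [|j r IH]; first by rewrite !big_nil col_mx0.
  rewrite !big_cons IH -add_col_mx peval_dsum -{1}[v j]vsubmxK.
  by rewrite mul_block_col !mul0mx addr0 add0r.
by rewrite mulrDr lerD.
Qed.

Lemma dle_weaken n (x : pt R d n) c c' : 0 <= c <= c' -> dle x c -> dle x c'.
Proof.
move=> /andP[c0 cc] h v; apply: le_trans (h v) _; apply: ler_wpM2r.
  by apply: sumr_ge0 => j _.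
by rewrite ler_pXn2r ?nnegrE // (le_trans c0).
Qed.

Lemma Gdelta_dsum n m (x : pt R d n) (y : pt R d m) :
  Gdelta delta (dsum x y) <-> Gdelta delta x /\ Gdelta delta y.
Proof.
split=> [/GdeltaP[c hc h]|[/GdeltaP[c /andP[c0 c1] hx] /GdeltaP[e /andP[e0 e1] hy]]].
  by split; apply/GdeltaP; exists c => //; [apply: dle_dsuml h|apply: dle_dsumr h].
apply/GdeltaP; exists (Num.max c e); first by rewrite le_max c0 gt_max c1 e1.
by apply: dle_dsum; [apply: dle_weaken hx|apply: dle_weaken hy];
  rewrite ?c0 ?e0 le_max lexx ?orbT.
Qed.

End BasicSets.

(** * Amplification: several vectors encoded in one *)

Section Amplification.
Variables (R : realType) (d a b : nat) (delta : 'M[fpoly R d]_(a, b)).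
Local Notation C := (R[i]).

(* The vectors [us] are stacked into one vector [v] of a direct sum of copies of [x]. *)
Lemma amplification (phi : graded_fun R d) n (x : pt R d n) c
    (us : seq 'cV[C]_n) :
  (0 < n)%N -> nc_fun_on (Gdelta delta) phi -> 0 <= c < 1 -> dle delta x c ->
  exists N (X : pt R d N) (E : nat -> 'M[C]_(n, N)) (v : 'cV[C]_N),
    [/\ (0 < N)%N, dle delta X c,
        forall i, (i < size us)%N -> E i *m v = nth 0 us i,
        forall i k, E i *m X k = x k *m E i
      & forall i, E i *m phi N X = phi n x *m E i].
Proof.
move=> n0 [phi_sum _] c1 xc; have xG : Gdelta delta x by apply/GdeltaP; exists c.
elim: us => [|u us [N [X [E [v [N0 Xc Ev EX Ephi]]]]]].
  (* The induction starts from one copy of [x], not from none, which keeps [N] positive. *)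
  exists n, x, (fun=> 1%:M), 0; split=> // *; by rewrite mul1mx mulmx1.
have XG : Gdelta delta X by apply/GdeltaP; exists c.
exists (n + N)%N, (dsum x X).
exists (fun i => if i is i'.+1 then row_mx 0 (E i') else row_mx 1%:M 0), (col_mx u v).
split.
- by rewrite addn_gt0 n0.
- exact: dle_dsum.
- by case=> [|i] /=; rewrite ?ltnS => h; rewrite mul_row_col mul0mx ?mul1mx ?addr0 ?add0r ?Ev.
- by case=> [|i] k; rewrite /dsum mul_row_block mul_mx_row !mul0mx ?mul1mx !mulmx0
     ?mulmx1 ?addr0 ?add0r ?EX.
- rewrite phi_sum //; case=> [|i]; rewrite mul_row_block mul_mx_row !mul0mx ?mul1mx !mulmx0
     ?mulmx1 ?addr0 ?add0r ?Ephi //.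
Qed.

End Amplification.
(** * Finite-dimensional Hahn-Banach theorem *)

Section HahnBanach.
Variable R : realType.
Local Notation C := (R[i]).

Definition sublinear (V : lmodType C) (p : V -> R) :=
  (forall u v, p (u + v) <= p u + p v) /\
  (forall t u, 0 < t -> p (t%:C%C *: u) = t * p u).

Section Sublinear.
Variables (V : lmodType C) (p : V -> R).
Hypothesis sub_p : sublinear p.

Lemma sublinear0 : p 0 = 0.
Proof. by have := sub_p.2 2 0 (ltr0n _ 2); rewrite scaler0; lra. Qed.

Lemma sublinearN u : - p u <= p (- u).
Proof. by have := sub_p.1 u (- u); rewrite subrr sublinear0; lra. Qed.

Lemma sublinear_wZ t u : 0 <= t -> p (t%:C%C *: u) = t * p u.
Proof.
rewrite le_eqVlt => /predU1P[<-|]; last exact: sub_p.2.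
by rewrite scale0r sublinear0 mul0r.
Qed.

(* The witness is [q z = inf_(t >= 0) (p (z + t v) - t p v)]; it is linear on the line
   spanned by [v], so that doing this for a spanning family replaces Zorn's lemma. *)
Lemma sublinear_step v :
  exists q, [/\ sublinear q, forall z, q z <= p z & q (- v) <= - p v].
Proof.
pose A z := [set r | exists2 t, 0 <= t & r = p (z + t%:C%C *: v) - t * p v]%classic.
pose q z := inf (A z).
have lbA z : lbound (A z) (- p (- z)).
  move=> _ [t t0 ->]; rewrite -sublinear_wZ //.
  have := sub_p.1 (z + t%:C%C *: v) (- z); rewrite addrC addKr.
  set x := p _; set y := p _; set w := p _; lra.
have infA z : has_inf (A z).
  by split; [exists (p (z + 0%:C%C *: v) - 0 * p v), 0 | exists (- p (- z))].
have q_le z t : 0 <= t -> q z <= p (z + t%:C%C *: v) - t * p v.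
  by move=> t0; apply: ge_inf; [exact: (infA z).2 | exists t].
have qZ t u : 0 < t -> q (t%:C%C *: u) <= t * q u.
  move=> t0; rewrite mulrC -ler_pdivrMr //; apply: lb_le_inf; first exact: (infA u).1.
  move=> _ [s s0 ->]; rewrite ler_pdivrMr //.
  apply: le_trans (q_le _ (t * s) _) _; first by rewrite mulr_ge0 // ltW.
  rewrite rmorphM /= -scalerA -scalerDr sub_p.2 //; lra.
exists q; split; first split.
- move=> u w; rewrite -lerBlDr; apply: lb_le_inf; first exact: (infA u).1.
  move=> _ [t t0 ->]; rewrite lerBlDl -lerBlDr.
  apply: lb_le_inf; first exact: (infA w).1.
  move=> _ [s s0 ->]; rewrite lerBlDr.
  apply: le_trans (q_le _ (t + s) _) _; first exact: addr_ge0.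
  have := sub_p.1 (u + t%:C%C *: v) (w + s%:C%C *: v).
  rewrite addrACA -scalerDl -rmorphD; lra.
- move=> t u t0; apply/eqP; rewrite eq_le qZ //=.
  have ti : 0 < t^-1 by rewrite invr_gt0.
  have := qZ t^-1 (t%:C%C *: u) ti.
  by rewrite scalerA -rmorphM mulVf ?gt_eqF // scale1r mulrC ler_pdivlMr // mulrC.
- by move=> z; have := q_le z 0 (lexx _); rewrite scale0r addr0 mul0r subr0.
- by have := q_le (- v) 1 ler01; rewrite scale1r addNr sublinear0 mul1r sub0r.
Qed.

End Sublinear.

(** A sublinear minorant of a functional odd at [v] is odd at [v] too, so the vectors of [l] can be
    treated one after another. *)
Lemma sublinear_odd_on (V : lmodType C) (p : V -> R) (l : seq V) : sublinear p ->
  exists q, [/\ sublinear q, forall z, q z <= p z & {in l, forall v, q (- v) = - q v}].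
Proof.
elim: l p => [|v l IH] p sp; first by exists p.
have [q [sq qp qv]] := sublinear_step sp v.
have [r [sr rq rl]] := IH q sq.
exists r; split=> // [z|u]; first exact: le_trans (qp z).
rewrite inE => /predU1P[->|/rl //]; apply/eqP; rewrite eq_le sublinearN // andbT.
by apply: le_trans (rq _) _; apply: le_trans qv _; rewrite lerN2; apply: le_trans (qp v).
Qed.

Lemma hahn_banach_mx N (p : 'M[C]_N -> R) (z0 : 'M[C]_N) : sublinear p ->
  exists f : 'M[C]_N -> R,
    [/\ forall u v, f (u + v) = f u + f v, forall t u, f (t%:C%C *: u) = t * f u,
        forall z, f z <= p z & p z0 <= f z0].
Proof.
(* Lowering [p] along [z0] first forces every linear minorant of [q] to reach [p z0] at [z0]. *)
move=> sp; have [q [sq qp qz]] := sublinear_step sp z0.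
(* The matrix units and their multiples by [i] span the matrices over the reals; the vectors where
   [f] is odd form a real subspace, and an odd sublinear functional is linear. *)
pose l := [seq delta_mx ij.1 ij.2 | ij : 'I_N * 'I_N] ++
          [seq 'i%C *: delta_mx ij.1 ij.2 | ij : 'I_N * 'I_N] : seq 'M[C]_N.
have [f [sf fq fl]] := sublinear_odd_on l sq.
pose odd (u : 'M[C]_N) := f (- u) = - f u.
have fD z u : odd u -> f (z + u) = f z + f u.
  move=> ou; apply/eqP; rewrite eq_le sf.1 /= -lerBrDr.
  by have := sf.1 (z + u) (- u); rewrite addrK ou.
have oN u : odd u -> odd (- u) by move=> ou; rewrite /odd opprK ou opprK.
have oD u v : odd u -> odd v -> odd (u + v).
  by move=> ou ov; rewrite /odd opprD (fD _ _ (oN _ ov)) fD // ou ov opprD.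
have oZ t u : odd u -> odd (t%:C%C *: u).
  have oZ0 s w : 0 <= s -> odd w -> odd (s%:C%C *: w).
    by move=> s0 ow; rewrite /odd -scalerN !(sublinear_wZ sf) // ow mulrN.
  case: (leP 0 t) => t0 ou; first exact: oZ0.
  rewrite -[t]opprK rmorphN /= scaleNr; apply: oN; apply: oZ0 => //.
  by rewrite oppr_ge0 ltW.
have o0 : odd 0 by rewrite /odd oppr0 (sublinear0 sf) oppr0.
have oA u : odd u.
  rewrite (matrix_sum_delta u); apply: (big_ind odd o0 oD) => i _.
  apply: (big_ind odd o0 oD) => j _.
  rewrite [u i j]complexE scalerDl mulrC -scalerA.
  by apply: oD; apply: oZ; apply: fl; rewrite mem_cat; apply/orP; [left|right];
    apply/mapP; exists (i, j); rewrite ?mem_enum.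
exists f; split=> [u v|t u|z|]; first exact: fD.
- case: (leP 0 t) => t0; first exact: sublinear_wZ.
  rewrite -{1}[t]opprK rmorphN /= scaleNr oA (sublinear_wZ sf) ?oppr_ge0 ?ltW //.
  by rewrite mulNr opprK.
- exact: le_trans (qp z).
- by rewrite -[f z0]opprK -oA -[p z0]opprK lerN2; apply: le_trans (fq _) qz.
Qed.

End HahnBanach.

(** * Positive definite forms *)

Section PositiveForms.
Variable R : realType.
Local Notation C := (R[i]).

Lemma conjCE (z : C) : Num.conj z = conjc z.
Proof. by []. Qed.

Lemma adjE m k (A : 'M[C]_(m, k)) i j : (A^t*) i j = Num.conj (A j i).
Proof. by rewrite !mxE. Qed.

Lemma conjmxM m k l (A : 'M[C]_(m, k)) (B : 'M[C]_(k, l)) : (A *m B)^t* = B^t* *m A^t*.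
Proof. by rewrite trmx_mul map_mxM. Qed.

Lemma nrm2E k (v : 'cV[C]_k) : (nrm2 v)%:C%C = (v^t* *m v) 0 0.
Proof.
rewrite mxE rmorph_sum; apply: eq_bigr => i _; rewrite !mxE /=.
by rewrite /sqn add_Re2_Im2 normCKC.
Qed.

Section Factor.
Variables (N : nat) (f : 'M[C]_N -> R).
Hypothesis fD : forall u v, f (u + v) = f u + f v.
Hypothesis fZ : forall t u, f (t%:C%C *: u) = t * f u.

(** The complex linear functional with real part [f]. *)
Let F (z : 'M[C]_N) : C := Complex (f z) (- f ('i%C *: z)).

Let FD u v : F (u + v) = F u + F v.
Proof. by rewrite /F scalerDr !fD opprD. Qed.

Let FZ (c : C) u : F (c *: u) = c * F u.
Proof.
have fc z : f (c *: z) = Re c * f z + Im c * f ('i%C *: z).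
  by rewrite {1}[c]complexE scalerDl fD fZ ['i%C * _]mulrC -scalerA fZ.
have ii (z : 'M[C]_N) : 'i%C *: ('i%C *: z) = (-1)%:C%C *: z.
  by rewrite scalerA -expr2 sqr_i rmorphN1.
rewrite /F scalerA mulrC -scalerA !fc ii fZ.
case: c {fc} => c e /=; congr Complex; ring.
Qed.

Let P : 'M[C]_N := \matrix_(k, l) F (delta_mx l k).

Let FE (u : 'cV[C]_N) : F (u *m u^t*) = (u^t* *m P *m u) 0 0.
Proof.
have F0 : F 0 = 0 by rewrite -(scale0r 0) FZ mul0r.
rewrite (matrix_sum_delta (u *m _)) (big_morph _ FD F0) mxE; apply: eq_bigr => l _.
rewrite (big_morph _ FD F0) mxE mulr_suml; apply: eq_bigr => k _.
by rewrite FZ !mxE big_ord1 !mxE; ring.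
Qed.

(** By the spectral theorem the form is given by [H = U^* D U] with [D > 0], and [s = D^(1/2) U]
    satisfies [s^* s = H]. *)
Lemma pos_form_factor :
  (forall u : 'cV_N, u != 0 -> 0 < f (u *m u^t*)) ->
  exists2 s : 'M[C]_N, s \in unitmx & forall u, nrm2 (s *m u) = f (u *m u^t*).
Proof.
(* On matrices [u u^*], [f] is the real part of the form of [P], hence the form of its Hermitian
   part. *)
move=> fpos; pose H := (2%:R^-1 : C) *: (P + P^t*).
have HE (u : 'cV[C]_N) : (u^t* *m H *m u) 0 0 = (f (u *m u^t*))%:C%C.
  have E2 : (u^t* *m P^t* *m u) 0 0 = conjc (F (u *m u^t*)).
    have -> : u^t* *m P^t* *m u = (u^t* *m P *m u)^t*.
      by rewrite !conjmxM trmxCK mulmxA.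
    by rewrite adjE FE conjCE.
  rewrite /H -scalemxAr -scalemxAl mxE mulmxDr mulmxDl mxE E2 -FE.
  rewrite addcJ /= mulrA mulVf ?mul1r // pnatr_eq0 //.
have Hh : H \is hermsymmx.
  apply/is_hermitianmxP; rewrite expr0 scale1r /H.
  apply/matrixP => i j; move: (P) => Q; rewrite !mxE.
  by rewrite rmorphM rmorphD /= conjCK fmorphV rmorph_nat [X in _ = _ * X]addrC.
have /orthomx_spectralP := hermitian_normalmx Hh.
set U := spectralmx H; set D := spectral_diag H => HD.
have Uu : U \is unitarymx := spectral_unitarymx H.
(* Each eigenvalue is the value of the form at a unit eigenvector. *)
have Dpos k : exists2 t, 0 < t & D 0 k = t%:C%C.
  pose u := invmx U *m delta_mx k 0 : 'cV[C]_N.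
  exists (f (u *m u^t*)).
    apply: fpos; apply/negP => /eqP u0.
    have := congr1 (mulmx U) u0; rewrite /u mulKVmx ?unitarymx_unit // mulmx0.
    by move=> /matrixP/(_ k 0)/eqP; rewrite !mxE !eqxx oner_eq0.
  rewrite -HE HD /u conjmxM invmx_unitary // trmxCK.
  have UU : U *m U^t* = 1%:M by apply/unitarymxP.
  rewrite !mulmxA -(mulmxA _ U) UU mulmx1 -(mulmxA _ U) UU mulmx1.
  rewrite -mulmxA -colE mxE (bigD1 k) //= big1 ?addr0 => [|j jk].
    by rewrite !mxE !eqxx rmorph1 mul1r.
  by rewrite !mxE (negPf jk) rmorph0 mul0r.
pose s := diag_mx (\row_k (Num.sqrt (Re (D 0 k)))%:C%C) *m U.
have ss : s^t* *m s = H.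
  rewrite HD /s conjmxM tr_diag_mx map_diag_mx invmx_unitary //.
  rewrite -mulmxA (mulmxA _ _ U) mulmx_diag mulmxA; congr (_ *m diag_mx _ *m _).
  apply/rowP => k; rewrite !mxE /= conjCE conjc_real -rmorphM -expr2 /=.
  by have [t t0 ->] := Dpos k; rewrite sqr_sqrtr // ltW.
have sE (u : 'cV[C]_N) : nrm2 (s *m u) = f (u *m u^t*).
  by apply: complexI; rewrite nrm2E -HE conjmxM -mulmxA (mulmxA _ s) ss mulmxA.
exists s => //; rewrite unitmx_mul (unitarymx_unit Uu) andbT unitmxE det_diag unitfE.
apply/prodf_neq0 => k _; rewrite mxE; have [t t0 ->] := Dpos k.
by rewrite /= -(rmorph0 (real_complex R)) (inj_eq (@complexI _)) gt_eqF // sqrtr_gt0.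
Qed.

End Factor.
End PositiveForms.
(** * Duality *)

Section Inner.
Variable R : realType.
Local Notation C := (R[i]).

Definition pr k (h w : 'cV[C]_k) : R := sqn ((h^t* *m w) 0 0).

Definition qf k (z : 'M[C]_k) (w : 'cV[C]_k) : R := Re ((w^t* *m z *m w) 0 0).

Lemma pr_ge0 k (h w : 'cV[C]_k) : 0 <= pr h w.
Proof. exact: sqn_ge0. Qed.

Lemma Re_dot k (u w : 'cV[C]_k) : Re ((u^t* *m w) 0 0) = rdot u w.
Proof.
rewrite mxE Re_sum; apply: eq_bigr => i _; rewrite !mxE conjCE.
by case: (u i 0) (w i 0) => [x y] [x' y'] /=; ring.
Qed.

Lemma sqnE (z : C) : (sqn z)%:C%C = Num.conj z * z.
Proof. by rewrite /sqn add_Re2_Im2 normCKC. Qed.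

(** With [z = h^* w], the real product of [z h] and [w] is [|z|^2]; real Cauchy-Schwarz gives
    [|z|^2 <= |z| |h| |w|], and a nonzero factor [|z|] cancels. *)
Lemma pr_le k (h w : 'cV[C]_k) : pr h w <= nrm2 h * nrm2 w.
Proof.
rewrite /pr; set z := _ 0 0.
have zE : sqn z = rdot (z *: h) w.
  rewrite -Re_dot; have -> : ((z *: h)^t* *m w) 0 0 = Num.conj z * z.
    by rewrite linearZ /= map_mxZ -scalemxAl mxE.
  by rewrite -sqnE.
have := rdot_le (z *: h) w; rewrite -zE vnormZ sqn_normc expr2 -mulrA.
have := normc_ge0 z; rewrite le_eqVlt => /predU1P[<- _|n0].
  by rewrite mul0r mulr_ge0.
rewrite ler_pM2l // -!vnorm_sq -exprMn -expr2 ler_pXn2r ?nnegrE ?normc_ge0 //.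
exact: mulr_ge0.
Qed.

Lemma qfD k (y z : 'M[C]_k) w : qf (y + z) w = qf y w + qf z w.
Proof. by rewrite /qf mulmxDr mulmxDl mxE ReD. Qed.

Lemma qfZ k t (z : 'M[C]_k) w : qf (t%:C%C *: z) w = t * qf z w.
Proof. by rewrite /qf -scalemxAr -scalemxAl mxE ReZ. Qed.

Lemma qfN k (z : 'M[C]_k) w : qf (- z) w = - qf z w.
Proof. by rewrite /qf mulmxN mulNmx mxE ReN. Qed.

Lemma qf0 k (w : 'cV[C]_k) : qf 0 w = 0.
Proof. by rewrite /qf mulmx0 mul0mx mxE. Qed.

Lemma qf1 k (w : 'cV[C]_k) : qf 1%:M w = nrm2 w.
Proof. by rewrite /qf mulmx1 -nrm2E. Qed.

Lemma qf_scalar k t (w : 'cV[C]_k) : qf t%:C%C%:M w = t * nrm2 w.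
Proof. by rewrite -scalemx1 qfZ qf1. Qed.

Lemma qf_outer k (h w : 'cV[C]_k) : qf (h *m h^t*) w = pr h w.
Proof.
rewrite /qf /pr mulmxA -mulmxA.
have -> : (w^t* *m h *m (h^t* *m w)) 0 0 = ((h^t* *m w)^t* *m (h^t* *m w)) 0 0.
  by rewrite conjmxM trmxCK.
by rewrite mxE big_ord1 adjE -sqnE.
Qed.

Lemma qf_sum k I (r : seq I) (F : I -> 'M[C]_k) w :
  qf (\sum_(i <- r) F i) w = \sum_(i <- r) qf (F i) w.
Proof. exact: (big_morph (fun z => qf z w) (fun y z => qfD y z w) (qf0 w)). Qed.

Lemma qf_le k (z : 'M[C]_k) w : qf z w <= opnorm z * nrm2 w.
Proof.
rewrite /qf -mulmxA Re_dot; apply: le_trans (rdot_le _ _) _.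
by rewrite -vnorm_sq expr2 mulrA [opnorm z * _]mulrC -mulrA ler_wpM2l // vnorm_mulmx.
Qed.

Lemma pr_delta k (h : 'cV[C]_k) : \sum_i pr h (delta_mx i 0) = nrm2 h.
Proof.
apply: eq_bigr => i _; rewrite /pr -colE !mxE conjCE; exact: sqnJ.
Qed.

Lemma qf_delta k (z : 'M[C]_k) : \sum_i qf z (delta_mx i 0) = Re (\tr z).
Proof.
rewrite Re_sum; apply: eq_bigr => i _; rewrite /qf -mulmxA -colE; congr Re.
rewrite mxE (bigD1 i) //= big1 ?addr0 => [|j ji]; rewrite !mxE.
  by rewrite !eqxx rmorph1 mul1r.
by rewrite (negPf ji) rmorph0 mul0r.
Qed.

Lemma tr_outer k (u : 'cV[C]_k) : Re (\tr (u *m u^t*)) = nrm2 u.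
Proof. by rewrite mxtrace_mulC trace_mx11 -nrm2E. Qed.

Lemma prZ k z (h w : 'cV[C]_k) : pr (z *: h) w = sqn z * pr h w.
Proof. by rewrite /pr linearZ /= map_mxZ -scalemxAl mxE sqnM /= conjCE sqnJ. Qed.

End Inner.

Section Duality.
Variables (R : realType) (d a b : nat) (delta : 'M[fpoly R d]_(a, b)).
Local Notation C := (R[i]).
Variables (N : nat) (X : pt R d N) (c0 : R).
Hypotheses (N0 : (0 < N)%N) (c0b : 0 <= c0 < 1) (Xc : dle delta X c0).

Definition gap (h : 'I_b -> 'cV[C]_N) (w : 'cV[C]_N) : R :=
  \sum_j pr (h j) w - \sum_i pr (dapply delta X h i) w.

(* Only the real part of the form of [z] matters, so [z] need not be Hermitian. *)
Definition cone (z : 'M[C]_N) :=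
  exists hs : seq ('I_b -> 'cV[C]_N), forall w, \sum_(h <- hs) gap h w <= qf z w.

Lemma cone_psd z : (forall w, 0 <= qf z w) -> cone z.
Proof. by move=> h; exists [::] => w; rewrite big_nil. Qed.

Lemma coneD y z : cone y -> cone z -> cone (y + z).
Proof.
by move=> [hs h] [hs' h']; exists (hs ++ hs') => w; rewrite big_cat qfD /= lerD.
Qed.

Lemma dapplyZ n (x : pt R d n) z (h : 'I_b -> 'cV[C]_n) i :
  dapply delta x (fun j => z *: h j) i = z *: dapply delta x h i.
Proof.
by rewrite /dapply scaler_sumr; apply: eq_bigr => j _; rewrite scalemxAr.
Qed.

Lemma coneZ t z : 0 < t -> cone z -> cone (t%:C%C *: z).
Proof.
move=> t0 [hs h]; exists [seq (fun j => (Num.sqrt t)%:C%C *: g j) | g : 'I_b -> 'cV[C]_N <- hs] => w.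
rewrite big_map qfZ; apply: le_trans (_ : t * \sum_(h <- hs) gap h w <= _); last first.
  by rewrite ler_pM2l.
rewrite mulr_sumr ler_sum // => g _; rewrite /gap mulrBr !mulr_sumr le_eqVlt.
apply/orP; left; apply/eqP.
by congr (_ - _); apply: eq_bigr => i _; rewrite ?dapplyZ prZ sqnR sqr_sqrtr // ltW.
Qed.

Lemma cone_gap (h : 'I_b -> 'cV[C]_N) : cone (\sum_j h j *m (h j)^t* -
  \sum_i dapply delta X h i *m (dapply delta X h i)^t*).
Proof.
exists [:: h] => w; rewrite big_seq1 qfD qfN !qf_sum /gap.
have E k (F : 'I_k -> 'cV[C]_N) : \sum_i qf (F i *m (F i)^t*) w = \sum_i pr (F i) w.
  by apply: eq_bigr => i _; apply: qf_outer.
by rewrite !E.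
Qed.

(** Summing a form over the standard basis gives its trace, and each generator has nonnegative trace
    because [|delta(X)| <= c0 < 1]. This bounds the gauge of the cone from below. *)
Lemma cone_trace z : cone z -> 0 <= Re (\tr z).
Proof.
move=> [hs h]; rewrite -qf_delta.
apply: le_trans (ler_sum _ (fun i _ => h (delta_mx i 0))); rewrite exchange_big /=.
apply: sumr_ge0 => g _; rewrite sumrB exchange_big [X in _ - X]exchange_big /= subr_ge0.
under eq_bigr do rewrite pr_delta; under [X in _ <= X]eq_bigr do rewrite pr_delta.
apply: le_trans (Xc g) _; rewrite ler_piMl //; first by apply: sumr_ge0.
by case/andP: c0b => *; rewrite expr_le1 // ltW.
Qed.

(** The infimum [p] of [A z] is the gauge of the cone relative to the identity, which is an order
    unit: [opnorm z] times it dominates [z]. *)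
Let A (z : 'M[C]_N) := [set r | cone (r%:C%C%:M - z)]%classic.
Let p z := inf (A z).

Let infA z : has_inf (A z).
Proof.
split.
  exists (opnorm z); apply: cone_psd => w; rewrite qfD qfN qf_scalar subr_ge0.
  exact: qf_le.
exists (Re (\tr z) / N%:R) => r /cone_trace.
rewrite linearB /= ReD ReN subr_ge0 mxtrace_scalar ler_pdivrMr ?ltr0n //.
by rewrite ReMn /= -[r *+ N]mulr_natr.
Qed.

Let p_le z r : A z r -> p z <= r.
Proof. by move=> h; apply: ge_inf; first exact: (infA z).2. Qed.

Let sublinear_p : sublinear p.
Proof.
have pZ t u : 0 < t -> p (t%:C%C *: u) <= t * p u.
  move=> t0; rewrite mulrC -ler_pdivrMr //; apply: lb_le_inf; first exact: (infA u).1.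
  move=> r Ar; rewrite ler_pdivrMr // mulrC; apply: p_le.
  by have := coneZ t0 Ar; rewrite /A /= scalerBr scale_scalar_mx -rmorphM.
split=> [u w|t u t0].
  rewrite -lerBlDr; apply: lb_le_inf; first exact: (infA u).1.
  move=> r Ar; rewrite lerBlDl -lerBlDr; apply: lb_le_inf; first exact: (infA w).1.
  move=> s As; rewrite lerBlDr; apply: p_le.
  by have := coneD As Ar; rewrite /A /= addrACA -opprD [w + u]addrC -raddfD -rmorphD.
apply/eqP; rewrite eq_le pZ //=; have ti : 0 < t^-1 by rewrite invr_gt0.
have := pZ t^-1 (t%:C%C *: u) ti.
by rewrite scalerA -rmorphM mulVf ?gt_eqF // scale1r mulrC ler_pdivlMr // mulrC.
Qed.

(* By Hahn-Banach a matrix outside the cone is separated from it by a positive form;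
   perturbing the form by a small multiple of the trace makes it definite, and it then
   comes from a similarity [s] that keeps [X] in the basic set. *)
Lemma cone_duality (T : 'M[C]_N) (K : R) :
  (forall s : 'M[C]_N, s \in unitmx ->
     (exists2 c, 0 <= c < 1 & forall h : 'I_b -> 'cV[C]_N,
        \sum_i nrm2 (s *m dapply delta X h i) <= c ^+ 2 * \sum_j nrm2 (s *m h j)) ->
     forall u, nrm2 (s *m (T *m u)) <= K ^+ 2 * nrm2 (s *m u)) ->
  forall (v : 'cV[C]_N) eta, 0 < eta ->
  cone ((K ^+ 2)%:C%C *: (v *m v^t*) - (T *m v) *m (T *m v)^t* + eta%:C%C%:M).
Proof.
move=> hT v eta eta0; apply: contrapT; set q := _ - _ => ncone.
(* If some [r < eta] were in [A (- q)], adding the positive multiple [eta - r] of the identity would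
   put [q + eta] into the cone. *)
have pq : eta <= p (- q).
  apply: lb_le_inf; first exact: (infA _).1.
  move=> r; rewrite /A /= opprK => Ar; rewrite leNgt; apply/negP => r_eta.
  apply: ncone; have -> : q + eta%:C%C%:M = (r%:C%C%:M + q) + (eta - r)%:C%C%:M.
    by rewrite rmorphB raddfB /= [RHS]addrC addrA subrK addrC.
  apply: coneD => //; apply: cone_psd => w; rewrite qf_scalar mulr_ge0 //.
  by rewrite subr_ge0 ltW.
have [f [fD fZ fp fq]] := hahn_banach_mx (- q) sublinear_p.
have fN z : f (- z) = - f z by rewrite -scaleN1r -(rmorphN1 (real_complex R)) fZ mulN1r.
have fsum I (r : seq I) (F : I -> 'M[C]_N) : f (\sum_(i <- r) F i) = \sum_(i <- r) f (F i).
  by apply: (big_morph f fD); rewrite -(scale0r 0) -(rmorph0 (real_complex R)) fZ mul0r.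
have f_ge0 z : cone z -> 0 <= f z.
  move=> cz; rewrite -oppr_le0 -fN; apply: le_trans (fp _) _; apply: p_le.
  by rewrite /A /= opprK raddf0 add0r.
have fo_ge0 (u : 'cV[C]_N) : 0 <= f (u *m u^t*).
  by apply: f_ge0; apply: cone_psd => w; rewrite qf_outer pr_ge0.
have fo_le (u : 'cV[C]_N) : f (u *m u^t*) <= nrm2 u.
  apply: le_trans (fp _) _; apply: p_le; apply: cone_psd => w.
  by rewrite qfD qfN qf_outer qf_scalar subr_ge0 pr_le.
have f_gap (h : 'I_b -> 'cV[C]_N) :
    \sum_i f (dapply delta X h i *m (dapply delta X h i)^t*) <= \sum_j f (h j *m (h j)^t*).
  by rewrite -subr_ge0 -!fsum -fN -fD; apply: f_ge0; apply: cone_gap.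
have key e : 0 < e -> 0 <= f q + e * Re (\tr q).
  move=> e0; pose g z := f z + e * Re (\tr z).
  have gD u w : g (u + w) = g u + g w by rewrite /g fD raddfD /= ReD; ring.
  have gZ t u : g (t%:C%C *: u) = t * g u by rewrite /g fZ linearZ /= ReZ; ring.
  have gE (u : 'cV[C]_N) : g (u *m u^t*) = f (u *m u^t*) + e * nrm2 u by rewrite /g tr_outer.
  have gpos (u : 'cV[C]_N) : u != 0 -> 0 < g (u *m u^t*).
    move=> u0; rewrite gE ltr_wpDl // mulr_gt0 // lt_neqAle nrm2_ge0 andbT eq_sym.
    by apply: contraNneq u0 => /nrm2_eq0 ->.
  have [s su sE] := pos_form_factor gD gZ gpos.
  have e1 : 0 < 1 + e by rewrite addr_gt0.
  have c2_ge0 : 0 <= (1 + e * c0 ^+ 2) / (1 + e).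
    by rewrite divr_ge0 ?(ltW e1) // addr_ge0 // mulr_ge0 ?sqr_ge0 // ltW.
  have c0lt : c0 ^+ 2 < 1 by case/andP: c0b => *; rewrite expr_lt1.
  have /(hT s su) : exists2 c, 0 <= c < 1 & forall h : 'I_b -> 'cV[C]_N,
        \sum_i nrm2 (s *m dapply delta X h i) <= c ^+ 2 * \sum_j nrm2 (s *m h j).
    (* With the sums named below, [S1 <= S3 <= S4] and [S2 <= c0^2 S4]; the quotient
       [(S1 + e S2) / (S3 + e S4)] is largest when all three are equalities, which gives this
       constant. *)
    exists (Num.sqrt ((1 + e * c0 ^+ 2) / (1 + e))).
      rewrite sqrtr_ge0 -[X in _ < X]sqrtr1 ltr_sqrt // ltr_pdivrMr // mul1r.
      by rewrite ltrD2l -[X in _ < X]mulr1 ltr_pM2l.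
    move=> h; rewrite sqr_sqrtr //.
    under eq_bigr do rewrite sE gE.
    under [X in _ <= _ * X]eq_bigr do rewrite sE gE.
    rewrite !big_split /= -!mulr_sumr.
    set S1 := \sum_i f _; set S2 := \sum_i nrm2 _; set S3 := \sum_i f _; set S4 := \sum_i nrm2 _.
    have h1 : S1 <= S3 := f_gap h.
    have h2 : S2 <= c0 ^+ 2 * S4 := Xc h.
    have h3 : S3 <= S4 by apply: ler_sum.
    rewrite mulrAC ler_pdivlMr // -subr_ge0.
    have -> : (1 + e * c0 ^+ 2) * (S3 + e * S4) - (S1 + e * S2) * (1 + e) =
      (1 + e) * (S3 - S1) + e * (1 + e) * (c0 ^+ 2 * S4 - S2) +
      e * (1 - c0 ^+ 2) * (S4 - S3) by ring.
    by rewrite !addr_ge0 // !mulr_ge0 ?subr_ge0 // ltW.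
  move=> /(_ v); rewrite !sE => gT.
  have -> : f q + e * Re (\tr q) = g q by [].
  have gN z : g (- z) = - g z by rewrite -scaleN1r -(rmorphN1 (real_complex R)) gZ mulN1r.
  by rewrite /q gD gN gZ subr_ge0.
have fq' : f q <= - eta by rewrite -[f q]opprK -fN lerN2; apply: le_trans pq fq.
set t := Re (\tr q) in key.
have t1 : 0 < `|t| + 1 by rewrite ltr_wpDl.
(* For [e = eta / (|t| + 1)] the trace term stays below [eta], so [f q + e t < 0], against [key]. *)
have := key _ (divr_gt0 eta0 t1).
rewrite leNgt => /negP; apply; rewrite -(ltr_pM2r t1) mul0r mulrDl.
have -> : eta / (`|t| + 1) * t * (`|t| + 1) = eta * t by field; rewrite gt_eqF.
have : eta * t < eta * (`|t| + 1) by rewrite ltr_pM2l // ltr_pwDr // ler_norm.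
have : f q * (`|t| + 1) <= - eta * (`|t| + 1) by rewrite ler_pM2r.
lra.
Qed.

End Duality.
(** * Realization *)

Section Douglas.
Variable R : realType.
Local Notation C := (R[i]).
Variables (N : nat) (I J : finType) (F : I -> 'cV[C]_N) (G : J -> 'cV[C]_N) (e : R).
Hypotheses (e0 : 0 < e) (Fe : forall w, e * nrm2 w <= \sum_i pr (F i) w).
Hypothesis FG : forall w, \sum_j pr (G j) w <= \sum_i pr (F i) w.

Let Q : 'M[C]_N := \sum_i F i *m (F i)^t*.

Let qfQ w : qf Q w = \sum_i pr (F i) w.
Proof. by rewrite qf_sum; apply: eq_bigr => i _; rewrite qf_outer. Qed.

(** The lower bound [Fe] makes the form of [Q] definite, so [Q] has trivial kernel. *)
Let unitQ : Q \in unitmx.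
Proof.
rewrite unitmxE unitfE -det_tr; apply/negP => /det0P[w w0 wQ].
have Qw : Q *m w^T = 0 by rewrite -[Q]trmxK -trmx_mul wQ trmx0.
have := Fe w^T; rewrite -qfQ /qf -mulmxA Qw mulmx0 mxE /= leNgt => /negP; apply.
rewrite mulr_gt0 // lt_neqAle nrm2_ge0 andbT eq_sym.
by apply: contraNneq w0 => /nrm2_eq0/(congr1 trmx); rewrite trmxK trmx0 => ->.
Qed.

Let hermQ : (invmx Q)^t* = invmx Q.
Proof.
rewrite trmx_inv map_invmx; congr invmx.
have adjD (A B : 'M[C]_N) : (A + B)^t* = A^t* + B^t*.
  by apply/matrixP => i j; rewrite !mxE rmorphD.
have adj0 : (0 : 'M[C]_N)^t* = 0 by apply/matrixP => i j; rewrite !mxE rmorph0.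
rewrite /Q (big_morph (fun A : 'M[C]_N => A^t*) adjD adj0); apply: eq_bigr => i _.
by rewrite conjmxM trmxCK.
Qed.

(* A form of Douglas' factorization lemma, with [V i j = F_i^* Q^-1 G_j]. *)
Lemma douglas : exists V : I -> J -> C,
  (forall j, G j = \sum_i V i j *: F i) /\
  (forall x : I -> C, \sum_j sqn (\sum_i V i j * x i) <= \sum_i sqn (x i)).
Proof.
exists (fun i j => ((F i)^t* *m invmx Q *m G j) 0 0); split=> [j|x].
  rewrite -[LHS](mulKVmx unitQ) {1}/Q mulmx_suml; apply: eq_bigr => i _.
  have E : (F i)^t* *m (invmx Q *m G j) = (((F i)^t* *m invmx Q *m G j) 0 0)%:M.
    by rewrite mulmxA -mx11_scalar.
  by rewrite -[LHS]mulmxA E mul_mx_scalar.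
pose w i : C := Num.conj (x i).
(* For this [y], [|G_j^* y|] is the modulus of the [j]-th component of [V x], so [FG] reduces the
   claim to [sum_i |F_i^* y|^2 <= |w|^2]. *)
pose y := invmx Q *m \sum_i w i *: F i.
have Vx j : sqn (\sum_i ((F i)^t* *m invmx Q *m G j) 0 0 * x i) = pr (G j) y.
  rewrite -sqnJ -conjCE rmorph_sum /= /pr /y mulmxA mulmx_sumr summxE; congr sqn.
  apply: eq_bigr => i _; rewrite rmorphM /= mulrC -scalemxAr [RHS]mxE; congr (_ * _).
  have -> : (G j)^t* *m invmx Q *m F i = ((F i)^t* *m invmx Q *m G j)^t*.
    by rewrite !conjmxM trmxCK hermQ mulmxA.
  by rewrite adjE.
rewrite (eq_bigr _ (fun j _ => Vx j)); apply: le_trans (FG y) _.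
have swE : \sum_i sqn (x i) = \sum_i sqn (w i).
  by apply: eq_bigr => i _; rewrite /w conjCE sqnJ.
pose f i := ((F i)^t* *m y) 0 0.
(* The family [f] is an orthogonal projection of [w]: their product is [y^* Q y = |f|^2], so
   [|f - w|^2 >= 0] reads [|f|^2 <= |w|^2]. *)
have : 0 <= \sum_i sqn (f i - w i) by apply: sumr_ge0 => i _; apply: sqn_ge0.
have -> : \sum_i sqn (f i - w i) =
    \sum_i sqn (f i) - 2 * Re (\sum_i Num.conj (f i) * w i) + \sum_i sqn (w i).
  rewrite Re_sum mulr_sumr -sumrB -big_split /=; apply: eq_bigr => i _.
  rewrite conjCE; case: (f i) (w i) => [p q] [p' q']; rewrite /sqn /=; ring.
have -> : \sum_i Num.conj (f i) * w i = (y^t* *m Q *m y) 0 0.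
  rewrite -mulmxA [Q *m y]mulKVmx // mulmx_sumr summxE; apply: eq_bigr => i _.
  rewrite -scalemxAr mxE mulrC; congr (_ * _).
  have -> : y^t* *m F i = ((F i)^t* *m y)^t* by rewrite [RHS]conjmxM trmxCK.
  by rewrite adjE.
rewrite -/(qf Q y) qfQ swE; have -> : \sum_i pr (F i) y = \sum_i sqn (f i) by [].
lra.
Qed.

End Douglas.

Section ContractionFamilies.
Variables (R : realType) (I J : finType) (V : I -> J -> R[i]).
Hypothesis contrV :
  forall x : I -> R[i], \sum_j sqn (\sum_i V i j * x i) <= \sum_i sqn (x i).

Lemma contraction_vec n (x : I -> 'cV[R[i]]_n) :
  \sum_j nrm2 (\sum_i V i j *: x i) <= \sum_i nrm2 (x i).
Proof.
rewrite exchange_big [X in _ <= X]exchange_big /=; apply: ler_sum => k _.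
apply: le_trans (contrV (fun i => x i k 0)); apply: ler_sum => j _.
by rewrite summxE; under eq_bigr do rewrite mxE.
Qed.

End ContractionFamilies.

Lemma sum_pair (A : zmodType) (I J : finType) (F : I * J -> A) :
  \sum_p F p = \sum_i \sum_j F (i, j).
Proof. by rewrite pair_bigA; apply: eq_bigr => -[]. Qed.

(** * Iteration of the realization along words in the entries of [delta] *)

Section Words.
Variables (R : realType) (d a b : nat) (delta : 'M[fpoly R d]_(a, b)).
Local Notation C := (R[i]).

Definition pword (w : seq ('I_a * 'I_b)) : fpoly R d :=
  foldr (fun ik q => pmul (delta ik.1 ik.2) q) [:: (1, [::])] w.

(** The words of length less than [m]; there are none for [m = 0], so the iteration starts from
    zero. *)
Fixpoint words m : seq (seq ('I_a * 'I_b)) :=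
  if m is m'.+1 then [::] :: [seq ik :: w | ik <- enum {: 'I_a * 'I_b}, w <- words m']
  else [::].

Section Realization.
Variables (I0 : finType) (L : nat) (K : R).
(* The two index types list the input and the output channels of the realization:
   the constant term, the error terms [I0], and the state variables. *)
Let I : finType := ('I_1 + (I0 + 'I_a * 'I_L))%type.
Let J : finType := ('I_1 + 'I_b * 'I_L)%type.
Variable V : I -> J -> C.
Hypothesis contrV :
  forall x : I -> C, \sum_j sqn (\sum_i V i j * x i) <= \sum_i sqn (x i).

(** Coefficient of a word in the formal solution of [G = V (K u, delta(x) G)], the index [l] running
    over the internal states. *)
Fixpoint coef (w : seq ('I_a * 'I_b)) (kap : J) : C :=
  if w is ik :: w'
  then \sum_(l < L) V (inr (inr (ik.1, l))) kap * coef w' (inr (ik.2, l))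
  else K%:C%C * V (inl 0) kap.

(** Each recursion step applies the contraction [V] to a vector of square norm at most [K^2]: the
    input [K] for the empty word, part of the coefficients of the tail otherwise. *)
Lemma coef_le w : \sum_kap sqn (coef w kap) <= K ^+ 2.
Proof.
elim: w => [|[i k] w IH] /=.
  pose x (i : I) : C := if i is inl _ then K%:C%C else 0.
  have xE : \sum_i sqn (x i) = K ^+ 2.
    by rewrite !big_sumType /= !big_ord1 sqnR !big1 ?addr0 // => l _; rewrite sqn0.
  have E j : K%:C%C * V (inl 0) j = \sum_i V i j * x i.
    by rewrite !big_sumType /= !big_ord1 mulrC !big1 ?addr0 // => l _; rewrite mulr0.
  by rewrite (eq_bigr _ (fun j _ => congr1 (@sqn R) (E j))) -xE; apply: contrV.
pose x (i' : I) : C := match i' with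
  | inr (inr il) => if il.1 == i then coef w (inr (k, il.2)) else 0 | _ => 0 end.
have E j : \sum_(l < L) V (inr (inr (i, l))) j * coef w (inr (k, l)) = \sum_i' V i' j * x i'.
  rewrite !big_sumType /= [X in _ = X + _]big1 => [|l _]; last by rewrite mulr0.
  rewrite [X in _ = _ + (X + _)]big1 => [|l _]; last by rewrite mulr0.
  rewrite !add0r sum_pair /=.
  rewrite (bigD1 i) //= eqxx [X in _ + X]big1 ?addr0 // => i' /negPf ->.
  by apply: big1 => l _; rewrite mulr0.
rewrite (eq_bigr _ (fun j _ => congr1 (@sqn R) (E j))); apply: le_trans (contrV x) _.
apply: le_trans IH; rewrite !big_sumType /= [X in X + _ <= _]big1 => [|l _]; last by rewrite sqn0.
rewrite [X in _ + (X + _) <= _]big1 => [|l _]; last by rewrite sqn0.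
rewrite !add0r !sum_pair /=.
rewrite (bigD1 i) //= eqxx [X in _ + X]big1 => [|i' /negPf ->]; last first.
  by apply: big1 => l _; rewrite sqn0.
rewrite addr0 [X in _ <= _ + X](bigD1 k) //=.
rewrite addrCA lerDl addr_ge0 ?sumr_ge0 // => [j _|j _]; first exact: sqn_ge0.
by apply: sumr_ge0 => l _; apply: sqn_ge0.
Qed.

Section AtPoint.
Variables (n : nat) (x : pt R d n) (u : 'cV[C]_n).

Definition partial m (kap : J) : 'cV[C]_n :=
  \sum_(w <- words m) coef w kap *: (peval (pword w) x *m u).

(** Splitting off the first letter of each nonempty word exhibits one step of the iteration. *)
Lemma partialS m kap : partial m.+1 kap = (K%:C%C * V (inl 0) kap) *: u +
  \sum_(il : 'I_a * 'I_L) V (inr (inr il)) kap *: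
     dapply delta x (fun k => partial m (inr (k, il.2))) il.1.
Proof.
rewrite /partial /= big_cons peval1 mul1mx; congr (_ + _).
rewrite big_allpairs_dep big_enum /= !sum_pair /=.
apply: eq_bigr => i _.
under [RHS]eq_bigr => l _.
  rewrite /dapply scaler_sumr.
  under eq_bigr do rewrite /partial mulmx_sumr scaler_sumr.
  over.
rewrite [RHS]exchange_big /=; apply: eq_bigr => k _.
rewrite [RHS]exchange_big /=; apply: eq_bigr => w _.
rewrite scaler_suml; apply: eq_bigr => l _.
by rewrite peval_mul -scalemxAr scalerA mulmxA.
Qed.

(* The exact state [G] solves [G = V (K u, f, delta(x) G)], the truncation solves the
   same equation with [f = 0]; so the error is contracted at each step, up to [f]. *)
Lemma partial_error (rho th : R) (f : I0 -> 'cV[C]_n) (G : J -> 'cV[C]_n) m :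
  0 <= rho < 1 -> dle delta x rho -> \sum_r nrm2 (f r) <= th ->
  (forall kap, G kap = (K%:C%C * V (inl 0) kap) *: u +
     (\sum_r V (inr (inl r)) kap *: f r +
      \sum_(il : 'I_a * 'I_L) V (inr (inr il)) kap *:
        dapply delta x (fun k => G (inr (k, il.2))) il.1)) ->
  (1 - rho ^+ 2) * nrm2 (G (inl 0) - partial m (inl 0)) <=
    rho ^+ (2 * m) * (K ^+ 2 * nrm2 u + th) + th.
Proof.
move=> /andP[r0 r1] xr fth GE.
have r2 : 0 < 1 - rho ^+ 2 by rewrite subr_gt0 expr_lt1.
(* [delta(x)] acts separately for each [l]; on the right the component [inl 0] is only added. *)
have state (D : J -> 'cV[C]_n) : \sum_(il : 'I_a * 'I_L)
    nrm2 (dapply delta x (fun k => D (inr (k, il.2))) il.1) <=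
    rho ^+ 2 * \sum_kap nrm2 (D kap).
  rewrite sum_pair exchange_big /=.
  apply: le_trans (ler_sum _ (fun l _ => xr (fun k => D (inr (k, l))))) _.
  rewrite -mulr_sumr ler_wpM2l ?sqr_ge0 // big_sumType /= exchange_big /=.
  by rewrite sum_pair lerDr sumr_ge0.
pose s m := \sum_kap nrm2 (G kap - partial m kap).
have s0 : (1 - rho ^+ 2) * s 0%N <= K ^+ 2 * nrm2 u + th.
  have -> : s 0%N = \sum_kap nrm2 (G kap).
    by apply: eq_bigr => kap _; rewrite /partial big_nil subr0.
  pose D (i : I) := match i with inl _ => K%:C%C *: u | inr (inl r) => f r
    | inr (inr il) => dapply delta x (fun k => G (inr (k, il.2))) il.1 end.
  have := contraction_vec contrV D.
  have -> : \sum_j nrm2 (\sum_i V i j *: D i) = \sum_kap nrm2 (G kap).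
    apply: eq_bigr => kap _; congr nrm2; rewrite GE !big_sumType /= big_ord1.
    by rewrite scalerA mulrC.
  rewrite !big_sumType /= !big_ord1 nrm2Z sqnR.
  by have := state G; rewrite big_sumType /= big_ord1; lra.
have sS k : s k.+1 <= th + rho ^+ 2 * s k.
  pose D (i : I) := match i with inl _ => 0 | inr (inl r) => f r
    | inr (inr il) => dapply delta x (fun k' => G (inr (k', il.2)) - partial k (inr (k', il.2))) il.1 end.
  have := contraction_vec contrV D.
  have -> : \sum_j nrm2 (\sum_i V i j *: D i) = s k.+1.
    apply: eq_bigr => kap _; congr nrm2.
    rewrite GE partialS !big_sumType /= big_ord1 scaler0 add0r.
    rewrite opprD addrACA subrr add0r -addrA -sumrB; congr (_ + _).
    apply: eq_bigr => il _; rewrite -scalerBr /dapply -sumrB; congr (_ *: _).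
    by apply: eq_bigr => j _; rewrite mulmxBr.
  move=> h; apply: le_trans h _; rewrite !big_sumType /= big_ord1 nrm2_0 add0r.
  by apply: lerD => //; apply: (state (fun kap => G kap - partial k kap)).
(* The recursion [sS] has fixed point [th / (1 - rho^2)]; the factor [1 - rho^2] on the left avoids
   the division. *)
have sm k : (1 - rho ^+ 2) * s k <= rho ^+ (2 * k) * (K ^+ 2 * nrm2 u + th) + th.
  have th0 : 0 <= th by apply: le_trans fth; apply: sumr_ge0.
  elim: k => [|k IH]; first by rewrite muln0 expr0 mul1r; lra.
  apply: le_trans (_ : (1 - rho ^+ 2) * (th + rho ^+ 2 * s k) <= _).
    by rewrite ler_pM2l.
  rewrite mulnS exprD -mulrA mulrDr mulrCA.
  have := ler_wpM2l (sqr_ge0 rho) IH; rewrite mulrDr; lra.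
apply: le_trans (sm m); rewrite ler_pM2l // /s big_sumType /= big_ord1.
by rewrite lerDl sumr_ge0.
Qed.

End AtPoint.
End Realization.
End Words.

(** * Approximation at a single point with bounded coefficients *)

Section SinglePoint.
Variables (R : realType) (d a b : nat) (delta : 'M[fpoly R d]_(a, b)).
Local Notation C := (R[i]).
Variables (phi : graded_fun R d) (K : R).
Hypotheses (K0 : 0 <= K) (phi_nc : nc_fun_on (Gdelta delta) phi).
Hypothesis phi_le : forall n, (0 < n)%N -> forall x : pt R d n,
  Gdelta delta x -> opnorm (phi x) <= K.

(** The hypothesis on [s] says that [Y = s X s^-1] stays in the basic set, where
    [phi Y = s phi(X) s^-1] is bounded by [K]. This is the input of [cone_duality]. *)
Lemma nc_similarity_bound N (X : pt R d N) (s : 'M[C]_N) :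
  (0 < N)%N -> Gdelta delta X -> s \in unitmx ->
  (exists2 c, 0 <= c < 1 & forall h : 'I_b -> 'cV[C]_N,
     \sum_i nrm2 (s *m dapply delta X h i) <= c ^+ 2 * \sum_j nrm2 (s *m h j)) ->
  forall u, nrm2 (s *m (phi X *m u)) <= K ^+ 2 * nrm2 (s *m u).
Proof.
move=> N0 XG su [c c1 hc] u.
have isu : invmx s \in unitmx by rewrite unitmx_inv.
pose Y := simil (invmx s) X.
have YG : Gdelta delta Y.
  apply/GdeltaP; exists c => // v.
  have E i : dapply delta Y v i = s *m dapply delta X (fun j => invmx s *m v j) i.
    rewrite /dapply mulmx_sumr; apply: eq_bigr => j _.
    by rewrite peval_simil // invmxK !mulmxA.
  rewrite (eq_bigr _ (fun i _ => congr1 (@nrm2 R N) (E i))).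
  apply: le_trans (hc _) _; rewrite le_eqVlt; apply/orP; left; apply/eqP.
  by congr (_ * _); apply: eq_bigr => j _; rewrite mulKVmx.
have phiY : phi Y = s *m phi X *m invmx s.
  by rewrite /Y phi_nc.2 // invmxK.
have -> : s *m (phi X *m u) = phi Y *m (s *m u) by rewrite phiY !mulmxA mulmxKV.
by apply: nrm2_mulmx; apply: phi_le.
Qed.

(** Lurking isometry: cone membership, evaluated at [w], compares the forms of the families [F] and
    [G] below, and [douglas] provides [V]. The slack [eta] yields the error channels ['I_N], which
    also give [F] its lower bound. *)
Lemma realization_at N (X : pt R d N) c (v : 'cV[C]_N) (eta : R) :
  (0 < N)%N -> 0 <= c < 1 -> dle delta X c -> 0 < eta ->
  exists (L : nat) (V : 'I_1 + ('I_N + 'I_a * 'I_L) -> 'I_1 + 'I_b * 'I_L -> C)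
      (h : 'I_L -> 'I_b -> 'cV[C]_N),
  let G (kap : 'I_1 + 'I_b * 'I_L) : 'cV[C]_N :=
    match kap with inl _ => phi X *m v | inr jl => h jl.2 jl.1 end in
  (forall x, \sum_j sqn (\sum_i V i j * x i) <= \sum_i sqn (x i)) /\
  forall kap, G kap = (K%:C%C * V (inl 0) kap) *: v +
    (\sum_r V (inr (inl r)) kap *: ((Num.sqrt eta)%:C%C *: delta_mx r 0) +
     \sum_(il : 'I_a * 'I_L) V (inr (inr il)) kap *:
       dapply delta X (fun k => G (inr (k, il.2))) il.1).
Proof.
move=> N0 c1 Xc eta0; have XG : Gdelta delta X by apply/GdeltaP; exists c.
have [hs hP] := cone_duality N0 c1 Xc
  (fun s su => nc_similarity_bound N0 XG su) v eta0.
pose L := size hs; pose h (l : 'I_L) := tnth (in_tuple hs) l.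
pose F (i : 'I_1 + ('I_N + 'I_a * 'I_L)) : 'cV[C]_N := match i with
  | inl _ => K%:C%C *: v | inr (inl r) => (Num.sqrt eta)%:C%C *: delta_mx r 0
  | inr (inr il) => dapply delta X (h il.2) il.1 end.
pose G (kap : 'I_1 + 'I_b * 'I_L) : 'cV[C]_N :=
    match kap with inl _ => phi X *m v | inr jl => h jl.2 jl.1 end.
have FE w : \sum_i pr (F i) w = K ^+ 2 * pr v w +
   (eta * nrm2 w + \sum_l \sum_i pr (dapply delta X (h l) i) w).
  rewrite !big_sumType /= big_ord1 prZ sqnR sum_pair exchange_big /=.
  congr (_ + (_ + _)); rewrite /nrm2 mulr_sumr; apply: eq_bigr => r _.
  rewrite prZ sqnR sqr_sqrtr ?ltW //; congr (_ * _).
  rewrite /pr; congr sqn; rewrite mxE (bigD1 r) //= big1 ?addr0 => [|k kr].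
    by rewrite adjE mxE !eqxx rmorph1 mul1r.
  by rewrite adjE mxE (negPf kr) rmorph0 mul0r.
have [w|w|V [VE contrV]] := @douglas R N _ _ F G eta eta0.
- rewrite FE addrCA lerDl addr_ge0 ?mulr_ge0 ?sqr_ge0 ?pr_ge0 // sumr_ge0 // => l _.
  by apply: sumr_ge0 => i _; apply: pr_ge0.
- rewrite FE big_sumType /= big_ord1 sum_pair exchange_big /=.
  have := hP w; rewrite !qfD qfN qfZ !qf_outer qf_scalar.
  rewrite [X in X <= _ -> _]big_tnth sumrB -/h.
  by set S1 := \sum_(l < L) _; set S2 := \sum_(l < L) _; lra.
exists L, V, h; split=> // kap; rewrite -/G [LHS]VE !big_sumType /= big_ord1 scalerA.
by rewrite mulrC.
Qed.

(** Amplification yields one [v] with [S u v = u] for every [u], where [S u] intertwines [X] with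
    [x]. Applying [S u] to the realization at [(X, v)] gives one at [(x, u)] with the same [V], so
    the coefficients do not depend on [u]. *)
Lemma single_point (rho eps : R) m : 0 <= rho < 1 -> 0 < eps ->
  2 * (rho ^+ (2 * m) * K ^+ 2) <= (1 - rho ^+ 2) * eps ^+ 2 ->
  forall n (x : pt R d n), (0 < n)%N -> dle delta x rho ->
  exists c : seq ('I_a * 'I_b) -> C, (forall w, sqn (c w) <= K ^+ 2) /\
    opnorm (phi x - \sum_(w <- words a b m) c w *: peval (pword delta w) x) <= eps.
Proof.
move=> rho1 eps0 hm n x n0 xr.
have [N [X [E [v [N0 Xr Ev EX Ephi]]]]] := amplification
  [seq delta_mx k 0 | k <- enum 'I_n] n0 phi_nc rho1 xr.
pose S (u : 'cV[C]_n) : 'M[C]_(n, N) := \sum_(k < n) u k 0 *: E k.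
have Sv u : S u *m v = u.
  rewrite [RHS]matrix_sum_delta mulmx_suml; apply: eq_bigr => k _.
  rewrite big_ord1 -scalemxAl Ev; last by rewrite size_map size_enum_ord.
  by rewrite (nth_map k) ?size_enum_ord // nth_ord_enum.
have SX (u : 'cV[C]_n) k : S u *m X k = x k *m S u.
  rewrite mulmx_suml mulmx_sumr; apply: eq_bigr => l _.
  by rewrite -scalemxAl -scalemxAr EX.
have Sphi u : S u *m phi X = phi x *m S u.
  rewrite mulmx_suml mulmx_sumr; apply: eq_bigr => l _.
  by rewrite -scalemxAl -scalemxAr Ephi.
(* [S u] is linear in [u], so the error vectors are fixed matrices applied to [u], and [eta * Th]
   bounds their total square norm relative to [|u|^2]. *)
pose B (r : 'I_N) : 'M[C]_n := \matrix_(i, k) E k i r.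
pose Th := \sum_r opnorm (B r) ^+ 2.
have Th0 : 0 <= Th by apply: sumr_ge0 => r _; apply: sqr_ge0.
have SB u r : S u *m delta_mx r 0 = B r *m u.
  apply/matrixP => i j; rewrite ord1 -colE mxE summxE mxE; apply: eq_bigr => k _.
  by rewrite !mxE mulrC.
have r2 : 0 < 1 - rho ^+ 2 by case/andP: rho1 => *; rewrite subr_gt0 expr_lt1.
(* The term in [K] takes half of [(1 - rho^2) eps^2]; the error occurs twice, once damped by a power
   of [rho], and gets a quarter each time. The [+ 1] keeps the denominator positive. *)
pose eta := (1 - rho ^+ 2) * eps ^+ 2 / (4 * (Th + 1)).
have Th1 : 0 < Th + 1 by rewrite ltr_wpDl.
have eta0 : 0 < eta by rewrite divr_gt0 ?mulr_gt0 // exprn_gt0.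
have etaTh : eta * Th <= (1 - rho ^+ 2) * eps ^+ 2 / 4.
  have -> : eta * Th = (1 - rho ^+ 2) * eps ^+ 2 / 4 * (Th / (Th + 1)).
    by rewrite /eta; field; rewrite gt_eqF.
  apply: ler_piMr; first by rewrite divr_ge0 // mulr_ge0 ?sqr_ge0 // ltW.
  by rewrite ler_pdivrMr // mul1r lerDl.
clearbody eta.
have [L [V [h [contrV GE]]]] := realization_at v N0 rho1 Xr eta0.
exists (fun w => coef K V w (inl 0)); split.
  move=> w; apply: le_trans (coef_le K contrV w); rewrite big_sumType /= big_ord1.
  by rewrite lerDl sumr_ge0 // => j _; apply: sqn_ge0.
apply: opnorm_le_nrm2; first exact: ltW.
move=> u.
pose G (kap : 'I_1 + 'I_b * 'I_L) : 'cV[C]_n :=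
  S u *m (match kap with inl _ => phi X *m v | inr jl => h jl.2 jl.1 end).
have fth : \sum_r nrm2 ((Num.sqrt eta)%:C%C *: (S u *m delta_mx r 0)) <= eta * Th * nrm2 u.
  rewrite /Th [eta * _]mulr_sumr mulr_suml; apply: ler_sum => r _.
  rewrite nrm2Z sqnR sqr_sqrtr ?(ltW eta0) // SB -mulrA ler_pM2l //.
  exact: nrm2_mulmx.
have := partial_error (K := K) (u := u) (G := G) contrV m rho1 xr fth.
have -> : G (inl 0) - partial delta K V x u m (inl 0) =
   (phi x - \sum_(w <- words a b m) coef K V w (inl 0) *: peval (pword delta w) x) *m u.
  rewrite mulmxBl /G mulmxA Sphi -mulmxA Sv; congr (_ - _).
  by rewrite mulmx_suml; apply: eq_bigr => w _; rewrite scalemxAl.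
move=> h1; rewrite -(ler_pM2l r2); apply: le_trans (h1 _) _ => {h1}.
  move=> kap; rewrite /G GE mulmxDr -scalemxAr Sv; congr (_ + _).
  rewrite mulmxDr !mulmx_sumr; congr (_ + _); apply: eq_bigr => i _.
    by rewrite -!scalemxAr.
  rewrite -scalemxAr /dapply mulmx_sumr; congr (_ *: _); apply: eq_bigr => j _.
  by rewrite mulmxA (peval_intertwine _ (fun k => esym (SX u k))) mulmxA.
have rm1 : rho ^+ (2 * m) <= 1 by case/andP: rho1 => *; rewrite exprn_ile1 // ltW.
have : rho ^+ (2 * m) * (eta * Th) <= eta * Th.
  by rewrite ler_piMl // mulr_ge0 // ltW.
move: (rho ^+ (2 * m)) (1 - rho ^+ 2) (eta * Th) hm r2 etaTh => t q e hm q0 he te.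
have -> : t * (K ^+ 2 * nrm2 u + e * nrm2 u) + e * nrm2 u =
  (t * K ^+ 2 + t * e + e) * nrm2 u by ring.
rewrite [q * _]mulrA ler_wpM2r //; lra.
Qed.

End SinglePoint.
(** * Compactness *)

Section Compactness.
Import numFieldNormedType.Exports.
Variable R : realType.
Local Notation C := (R[i]).

(** Bernoulli's inequality for [t^-1 = 1 + h]; the case [t = 0] is separate. *)
Lemma pow_small (t B e : R) : 0 <= t < 1 -> 0 < e -> exists m, t ^+ m * B <= e.
Proof.
move=> /andP[]; rewrite le_eqVlt => /predU1P[<- _ e0|t0 t1 e0].
  by exists 1%N; rewrite expr1 mul0r ltW.
pose h := t^-1 - 1; have h0 : 0 < h by rewrite subr_gt0 invf_gt1.
have bern m : 1 + m%:R * h <= t^-1 ^+ m.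
  elim: m => [|m IH]; first by rewrite mul0r addr0 expr0.
  rewrite exprS; apply: le_trans (_ : t^-1 * (1 + m%:R * h) <= _).
    have -> : t^-1 = 1 + h by rewrite /h addrC subrK.
    have : 0 <= h * (m%:R * h) by rewrite !mulr_ge0 // ltW.
    by rewrite -natr1; lra.
  by rewrite ler_pM2l // invr_gt0.
pose m := Num.bound `|B / e / h|.
have hm : B / e / h < m%:R by apply: le_lt_trans (ler_norm _) (archi_boundP (normr_ge0 _)).
exists m; rewrite mulrC -ler_pdivlMr ?exprn_gt0 // -exprVn -ler_pdivrMl // mulrC.
apply: le_trans (bern m); move: hm; rewrite ltr_pdivrMr // => hm.
by rewrite ltW // (lt_trans hm) // ltrDr.
Qed.

(** By Tychonoff's theorem the filter generated by the bounded members of the directed family [S]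
    has a cluster point. It need not lie in any [S i], but is approached from each on finite
    lists. *)
Lemma bounded_cluster (W : choiceType) (I : Type) (D : set I)
    (S : I -> set (W -> C)) (K : R) : 0 <= K ->
  (exists i, D i) ->
  (forall i j, D i -> D j -> exists2 k, D k & (S k `<=` S i `&` S j)%classic) ->
  (forall i, D i -> exists2 c, S i c & forall w, sqn (c w) <= K ^+ 2) ->
  exists c, forall i, D i -> forall (l : seq W) e, 0 < e ->
    exists2 c', S i c' & {in l, forall w, sqn (c w - c' w) <= e}.
Proof.
move=> K0 D0 Ddir Snon.
(* The boolean separates real and imaginary parts, so that the factors of the product are real
   segments. *)
pose cplx (f : bool * W -> R) (w : W) : C := Complex (f (true, w)) (f (false, w)).
pose A := [set f : {ptws bool * W -> R} | forall i, `[- K, K]%classic (f i)]%classic.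
have cA : compact A.
  apply: (@tychonoff _ (fun=> R) (fun=> `[- K, K]%classic)) => i.
  exact: segment_compact.
pose F : set_system {ptws bool * W -> R} :=
  filter_from D (fun i => A `&` [set f | S i (cplx f)])%classic.
have fF : Filter F.
  apply: filter_from_filter => // i j Di Dj; have [k Dk kij] := Ddir i j Di Dj.
  by exists k => // f [Af /kij[]].
have pF : ProperFilter F.
  apply: filter_from_proper => i Di; have [c Sc cK] := Snon i Di.
  exists (fun bw => if bw.1 then Re (c bw.2) else Im (c bw.2)); split.
    have le_K x y : x ^+ 2 + y ^+ 2 <= K ^+ 2 -> - K <= x <= K.
      move=> xy; rewrite -ler_norml -(ler_pXn2r (ltn0Sn 1)) ?nnegrE // real_normK ?num_real //.
      by apply: le_trans xy; rewrite lerDl sqr_ge0.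
    move=> [[] w] /=; rewrite in_itv /=; first exact: le_K _ _ (cK w).
    by have := cK w; rewrite /sqn addrC; apply: le_K.
  by rewrite /= /cplx /=; have -> : (fun w => Complex (Re (c w)) (Im (c w))) = c
    by apply: funext => w; case: (c w).
have FA : F A by have [i Di] := D0; exists i => // f [].
have [f [_ fF']] := cA F pF FA.
exists (cplx f) => i Di l e e0.
pose r := Num.sqrt (e / 2).
have r0 : 0 < r by rewrite sqrtr_gt0 divr_gt0.
have nb b : nbhs f [set g : {ptws bool * W -> R} | {in l, forall w, `|f (b, w) - g (b, w)| < r}]%classic.
  elim: l => [|w l IH]; first by apply: filterS (filterT) => g _ w.
  have nw : nbhs f [set g : {ptws bool * W -> R} | `|f (b, w) - g (b, w)| < r]%classic.
    exact: (@proj_continuous _ (fun=> R) (b, w) f _ (nbhsx_ballx (f (b, w)) r r0)).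
  apply: (@filterS _ (nbhs f) _ _ _ _ (@filterI _ (nbhs f) _ _ _ nw IH)) => g [gw gl] w'.
  by rewrite inE => /predU1P[->//|/gl].
have Fi : F (A `&` [set g | S i (cplx g)])%classic by exists i.
have [g [[_ Sg] [gt gf]]] := fF' _ _ Fi (filterI (nb true) (nb false)).
exists (cplx g) => // w wl; rewrite /sqn /=.
have sq x : `|x| < r -> x ^+ 2 <= e / 2.
  move=> xr; rewrite -(sqr_sqrtr (ltW (divr_gt0 e0 (ltr0n _ 2)))) -/r.
  by rewrite -(real_normK (num_real x)) ler_pXn2r ?nnegrE ?normr_ge0 ?(ltW r0) // ltW.
have := sq _ (gt w wl); have := sq _ (gf w wl); lra.
Qed.

End Compactness.
(** * Local approximation *)

Section Approximation.
Variables (R : realType) (d : nat).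
Local Notation C := (R[i]).

Section WordPolynomials.
Variables (a b : nat) (delta : 'M[fpoly R d]_(a, b)).

Definition wpoly m (c : seq ('I_a * 'I_b) -> C) : fpoly R d :=
  flatten [seq pscale (c w) (pword delta w) | w <- words a b m].

Lemma peval_wpoly m c n (x : pt R d n) :
  peval (wpoly m c) x = \sum_(w <- words a b m) c w *: peval (pword delta w) x.
Proof.
rewrite /wpoly; elim: (words a b m) => [|w l IH] /=; first by rewrite big_nil peval_nil.
by rewrite big_cons peval_cat peval_scale IH.
Qed.

(** The sets [S] of admissible coefficients are nonempty by [single_point] and directed because an
    approximation at [dsum x y] is one at both summands. A cluster point then serves all [x] at
    once. *)
Lemma bounded_nc_approx (phi : graded_fun R d) (K rho eps : R) :
  0 <= K -> nc_fun_on (Gdelta delta) phi ->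
  (forall n, (0 < n)%N -> forall x : pt R d n, Gdelta delta x -> opnorm (phi n x) <= K) ->
  0 <= rho < 1 -> 0 < eps ->
  exists p : fpoly R d, forall n, (0 < n)%N -> forall x : pt R d n,
    dle delta x rho -> opnorm (phi n x - peval p x) <= eps.
Proof.
move=> K0 phi_nc phi_le rho1 eps0.
have e2 : 0 < eps / 2 by rewrite divr_gt0.
have /andP[r0 r1] := rho1.
have r2 : 0 <= rho ^+ 2 < 1 by rewrite sqr_ge0 expr_lt1.
have [m hm] : exists m, (rho ^+ 2) ^+ m * (2 * K ^+ 2) <= (1 - rho ^+ 2) * (eps / 2) ^+ 2.
  by apply: pow_small => //; rewrite mulr_gt0 ?exprn_gt0 // subr_gt0; case/andP: r2.
pose D := [set i : {n & pt R d n} |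
  (0 < projT1 i)%N /\ dle delta (projT2 i) rho]%classic.
pose S (i : {n & pt R d n}) := [set c : seq ('I_a * 'I_b) -> C |
  opnorm (phi (projT1 i) (projT2 i) - peval (wpoly m c) (projT2 i)) <= eps / 2]%classic.
have [D0|nD] := pselect (exists i, D i); last first.
  by exists [::] => n n0 x xr; case: nD; exists (existT _ n x).
have inG n (x : pt R d n) : dle delta x rho -> Gdelta delta x.
  by move=> xr; apply/GdeltaP; exists rho.
have Sdir i j : D i -> D j -> exists2 k, D k & (S k `<=` S i `&` S j)%classic.
  case: i j => [n x] [k y] [/= n0 xr] [/= k0 yr].
  exists (existT _ (n + k)%N (dsum x y)).
    by split=> /=; [rewrite addn_gt0 n0 | apply: dle_dsum].
  move=> c; rewrite /S /= phi_nc.1; do ?[by [] | exact: inG].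
  rewrite peval_dsum opp_block_mx add_block_mx !subr0 => h.
  split; apply: le_trans h.
    by apply: opnorm_sub (block_diag_inl _ _) => v; apply: nrm2_inl.
  by apply: opnorm_sub (block_diag_inr _ _) => v; apply: nrm2_inr.
have Snon i : D i -> exists2 c, S i c & forall w, sqn (c w) <= K ^+ 2.
  case: i => n x [/= n0 xr].
  have [|c [cK hc]] := single_point K0 phi_nc phi_le (m := m) rho1 e2 _ n0 xr.
    by rewrite exprM; move: hm; lra.
  by exists c; [rewrite /S /= peval_wpoly; exact: hc | exact: cK].
have [c hc] := bounded_cluster K0 D0 Sdir Snon.
exists (wpoly m c) => n n0 x xr.
pose B := \sum_(w <- words a b m) opnorm (peval (pword delta w) x).
have B0 : 0 <= B by apply: sumr_ge0.
have B1 : 0 < B + 1 by rewrite ltr_wpDl.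
(* Exchanging [c'] for the cluster point costs at most [r * B <= eps / 2] at this [x];
   [bounded_cluster] compares squared moduli, hence [r ^+ 2]. *)
pose r := eps / 2 / (B + 1).
have rpos : 0 < r by rewrite divr_gt0.
have Dx : D (existT _ n x) by split.
have [c' Sc' cc'] := hc _ Dx (words a b m) (r ^+ 2) (exprn_gt0 2 rpos).
have -> : phi n x - peval (wpoly m c) x =
  (phi n x - peval (wpoly m c') x) + - (peval (wpoly m c) x - peval (wpoly m c') x).
  by rewrite opprB addrA subrK.
apply: le_trans (opnormD _ _) _; rewrite opnormN (_ : eps = eps / 2 + eps / 2); last by field.
apply: lerD Sc' _; rewrite !peval_wpoly -sumrB.
apply: le_trans (opnorm_sum _ _) _.
apply: le_trans (_ : r * B <= _); last first.
  have -> : eps / 2 = r * (B + 1) by rewrite /r divfK // gt_eqF.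
  by rewrite ler_pM2l // lerDl.
rewrite /B mulr_sumr big_seq [X in _ <= X]big_seq; apply: ler_sum => w wl.
rewrite -scalerBl; apply: le_trans (opnormZ _ _) _; rewrite ler_wpM2r //.
by rewrite -(ler_pXn2r (ltn0Sn 1)) ?nnegrE ?normc_ge0 ?(ltW rpos) // -sqn_normc; apply: cc'.
Qed.

(** Used with [t < 1] to shrink a basic set to [|delta(x)| < t], where the iteration converges
    uniformly. *)
Lemma dle_scale (t e : R) n (x : pt R d n) : 0 < t ->
  dle (map_mx (pscale t^-1%:C%C) delta) x e <-> dle delta x (t * e).
Proof.
move=> t0.
have E v i : dapply (map_mx (pscale t^-1%:C%C) delta) x v i = t^-1%:C%C *: dapply delta x v i.
  rewrite /dapply scaler_sumr; apply: eq_bigr => j _.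
  by rewrite mxE peval_scale scalemxAl.
have E2 v : \sum_i nrm2 (dapply (map_mx (pscale t^-1%:C%C) delta) x v i) =
    t ^- 2 * \sum_i nrm2 (dapply delta x v i).
  by rewrite mulr_sumr; apply: eq_bigr => i _; rewrite E nrm2Z sqnR exprVn.
have t2 : 0 < t ^+ 2 by rewrite exprn_gt0.
by split=> h v; have := h v; rewrite E2 exprMn -[t ^+ 2 * _ * _]mulrA ler_pdivrMl.
Qed.

End WordPolynomials.

Lemma Gdelta_open a b (delta : 'M[fpoly R d]_(a, b)) : free_open (Gdelta delta).
Proof. by move=> n n0 M MG; exists a, b, delta; split=> // k k0 x. Qed.

Lemma holomorphic_approx (D : ncset R d) (phi : graded_fun R d) :
  free_holomorphic D phi -> locally_approx_poly D phi.
Proof.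
move=> hol n n0 M MD eps eps0.
have [a [b [delta [/GdeltaP[c /andP[c0 c1] Mc] [_ [phi_nc [K phiK]]]]]]] := hol n n0 M MD.
(* A radius strictly between [c] and [1], so that [|delta(x)| < rho] is a neighbourhood of [M]. *)
pose rho := (1 + c) / 2.
have rho0 : 0 < rho by rewrite /rho; lra.
have rho1 : 0 <= rho < 1 by rewrite /rho; lra.
have phiK' k (k0 : (0 < k)%N) (x : pt R d k) : Gdelta delta x -> opnorm (phi k x) <= `|K|.
  by move=> xG; apply: le_trans (phiK k k0 x xG) (ler_norm _).
have e2 : 0 < eps / 2 by rewrite divr_gt0.
have [p hp] := bounded_nc_approx (normr_ge0 K) phi_nc phiK' rho1 e2.
pose delta' := map_mx (pscale rho^-1%:C%C) delta.
exists (Gdelta delta'), p; split; first exact: Gdelta_open.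
split.
  apply/GdeltaP; exists (c / rho).
    by rewrite divr_ge0 //= ?ltr_pdivrMr ?mul1r // ?(ltW rho0) // /rho; lra.
  by apply/dle_scale => //; rewrite mulrC divfK // gt_eqF.
exists (eps / 2); first by lra.
move=> k k0 x /GdeltaP[e /andP[e0 e1] /dle_scale xe] _; apply: hp => //.
apply: dle_weaken (xe rho0); rewrite mulr_ge0 ?(ltW rho0) //=.
by rewrite ler_piMr // ltW.
Qed.

(** The blocks act on separate components, the empty list being the zero polynomial. Basic sets are
    thus stable under intersection. *)
Lemma Gdelta_block a1 b1 a2 b2 (d1 : 'M[fpoly R d]_(a1, b1)) (d2 : 'M[fpoly R d]_(a2, b2))
    n (x : pt R d n) :
  Gdelta (block_mx d1 (const_mx [::]) (const_mx [::]) d2) x <->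
  Gdelta d1 x /\ Gdelta d2 x.
Proof.
set dd := block_mx _ _ _ _.
have El v i : dapply dd x v (lshift a2 i) = dapply d1 x (fun j => v (lshift b2 j)) i.
  rewrite /dapply big_split_ord /= [X in _ + X]big1 ?addr0 => [|j _].
    by apply: eq_bigr => j _; rewrite block_mxEul.
  by rewrite block_mxEur mxE peval_nil mul0mx.
have Er v i : dapply dd x v (rshift a1 i) = dapply d2 x (fun j => v (rshift b1 j)) i.
  rewrite /dapply big_split_ord /= [X in X + _]big1 ?add0r => [|j _].
    by apply: eq_bigr => j _; rewrite block_mxEdr.
  by rewrite block_mxEdl mxE peval_nil mul0mx.
have E v : \sum_i nrm2 (dapply dd x v i) =
    \sum_i nrm2 (dapply d1 x (fun j => v (lshift b2 j)) i) +
    \sum_i nrm2 (dapply d2 x (fun j => v (rshift b1 j)) i).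
  by rewrite big_split_ord /=; congr (_ + _); apply: eq_bigr => i _; rewrite ?El ?Er.
have dleP c : dle dd x c <-> dle d1 x c /\ dle d2 x c.
  split=> [h|[h1 h2] v]; last by rewrite E big_split_ord /= mulrDr lerD.
  have glue (v1 : 'I_b1 -> 'cV[C]_n) (v2 : 'I_b2 -> 'cV[C]_n) :
      \sum_i nrm2 (dapply d1 x v1 i) + \sum_i nrm2 (dapply d2 x v2 i) <=
      c ^+ 2 * (\sum_j nrm2 (v1 j) + \sum_j nrm2 (v2 j)).
    pose v j := match split j with inl i => v1 i | inr i => v2 i end.
    have vl j : v (lshift b2 j) = v1 j by rewrite /v (unsplitK (inl j)).
    have vr j : v (rshift b1 j) = v2 j by rewrite /v (unsplitK (inr j)).
    have := h v; rewrite E (funext vl : (fun j => v (lshift b2 j)) = v1).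
    rewrite (funext vr : (fun j => v (rshift b1 j)) = v2) big_split_ord /=.
    rewrite (eq_bigr _ (fun j _ => congr1 (@nrm2 R n) (vl j))).
    by rewrite (eq_bigr _ (fun j _ => congr1 (@nrm2 R n) (vr j))).
  split=> v.
    apply: le_trans (_ : _ <= c ^+ 2 * (\sum_j nrm2 (v j) + \sum_(j < b2) nrm2 (0 : 'cV[C]_n))) _.
      by apply: le_trans (glue v (fun=> 0)); rewrite lerDl sumr_ge0.
    by rewrite [X in _ + X]big1 ?addr0 // => j _; rewrite nrm2_0.
  apply: le_trans (_ : _ <= c ^+ 2 * (\sum_(j < b1) nrm2 (0 : 'cV[C]_n) + \sum_j nrm2 (v j))) _.
    by apply: le_trans (glue (fun=> 0) v); rewrite lerDr sumr_ge0.
  by rewrite [X in X + _]big1 ?add0r // => j _; rewrite nrm2_0.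
split=> [/GdeltaP[c c1 /dleP[h1 h2]]|].
  by split; apply/GdeltaP; exists c.
move=> [/GdeltaP[c /andP[c0 c1] h1] /GdeltaP[e /andP[e0 e1] h2]].
apply/GdeltaP; exists (Num.max c e); first by rewrite le_max c0 gt_max c1 e1.
by apply/dleP; split; [apply: dle_weaken h1|apply: dle_weaken h2];
  rewrite ?c0 ?e0 le_max lexx ?orbT.
Qed.

Lemma Gdelta_poly (p : fpoly R d) n (x : pt R d n) :
  Gdelta (const_mx p : 'M_(1, 1)) x <-> opnorm (peval p x) < 1.
Proof.
have E v i : dapply (const_mx p : 'M_(1, 1)) x v i = peval p x *m v 0.
  by rewrite /dapply big_ord1 mxE.
split=> [/GdeltaP[c /andP[c0 c1] h]|h].
  apply: le_lt_trans c1; apply: opnorm_le_nrm2 => // v.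
  by have := h (fun=> v); rewrite !big_ord1 E.
apply/GdeltaP; exists (opnorm (peval p x)); first by rewrite opnorm_ge0.
by move=> v; rewrite !big_ord1 E; apply: nrm2_mulmx.
Qed.

Lemma opnorm_block_diag n m (A : 'M[C]_n) (B : 'M[C]_m) :
  opnorm (block_mx A 0 0 B) <= opnorm A + opnorm B.
Proof.
apply: opnorm_le_nrm2 => [|v]; first exact: addr_ge0.
rewrite -[v]vsubmxK mul_block_col !mul0mx addr0 add0r !nrm2_col_mx mulrDr.
by apply: lerD; apply: nrm2_mulmx; rewrite ?lerDl ?lerDr.
Qed.

Lemma le0_of_small (z c : R) : 0 < c -> (forall e, 0 < e -> z <= c * e) -> z <= 0.
Proof.
move=> c0 h; rewrite leNgt; apply/negP => z0.
have := h (z / (2 * c)) (divr_gt0 z0 (mulr_gt0 (ltr0n _ 2) c0)).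
have -> : c * (z / (2 * c)) = z / 2 by field; rewrite gt_eqF.
lra.
Qed.

(** * From local approximation to holomorphy *)

Section Converse.
Variables (D : ncset R d) (phi : graded_fun R d).
Hypothesis approx : locally_approx_poly D phi.

(* A basic neighbourhood of a direct sum contains its summands, so one polynomial
   approximates at all three points. *)
Lemma approx_dsum n m (x : pt R d n) (y : pt R d m) e :
  (0 < n)%N -> (0 < m)%N -> D x -> D y -> D (dsum x y) -> 0 < e ->
  exists p : fpoly R d, [/\ opnorm (phi x - peval p x) <= e,
    opnorm (phi y - peval p y) <= e &
    opnorm (phi (dsum x y) - peval p (dsum x y)) <= e].
Proof.
move=> n0 m0 xD yD zD e0; have nm0 : (0 < n + m)%N by rewrite addn_gt0 n0.
have [U [p [Uo [zU [r re hr]]]]] := approx nm0 zD e0.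
have [a [b [delta [zG GU]]]] := Uo _ nm0 _ zU.
have [xG yG] := (Gdelta_dsum delta x y).1 zG.
by exists p; split; apply: le_trans (ltW re); apply: hr => //; apply: GU.
Qed.

(** Polynomials satisfy both identities exactly, so the defect of [phi] is at most a constant times
    the approximation error, which is arbitrary. *)
Lemma approx_nc a b (delta : 'M[fpoly R d]_(a, b)) :
  ncsubset (Gdelta delta) D -> nc_fun_on (Gdelta delta) phi.
Proof.
move=> GD; split=> [n m n0 m0 x y xG yG|n n0 s x su xG yG].
  have zG : Gdelta delta (dsum x y) by apply/Gdelta_dsum.
  have nm0 : (0 < n + m)%N by rewrite addn_gt0 n0.
  apply/eqP; rewrite -subr_eq0; apply/eqP/opnorm_eq0.
  (* One error at the direct sum and one for each diagonal block. *)
  apply: (@le0_of_small _ 3) => // e e0.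
  have [p [hx hy hz]] := approx_dsum n0 m0 (GD _ n0 _ xG) (GD _ m0 _ yG) (GD _ nm0 _ zG) e0.
  have -> : phi (dsum x y) - block_mx (phi x) 0 0 (phi y) =
     (phi (dsum x y) - peval p (dsum x y)) -
     block_mx (phi x - peval p x) 0 0 (phi y - peval p y).
    have -> : block_mx (phi x - peval p x) 0 0 (phi y - peval p y) =
        block_mx (phi x) 0 0 (phi y) - peval p (dsum x y).
      by rewrite peval_dsum opp_block_mx add_block_mx !subr0.
    by rewrite opprB addrA subrK.
  apply: le_trans (opnormD _ _) _; rewrite opnormN.
  rewrite (_ : 3 * e = e + (e + e)); last by ring.
  by apply: lerD hz _; apply: le_trans (opnorm_block_diag _ _) _; apply: lerD.
have zG : Gdelta delta (dsum x (simil s x)) by apply/Gdelta_dsum.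
have nn0 : (0 < n + n)%N by rewrite addn_gt0 n0.
apply/eqP; rewrite -subr_eq0; apply/eqP/opnorm_eq0.
(* Conjugation by [s] enlarges the error at [x] by at most this factor. *)
pose c := opnorm (invmx s) * opnorm s.
have c0 : 0 <= c by rewrite mulr_ge0.
apply: (@le0_of_small _ (1 + c)) => [|e e0]; first by rewrite ltr_wpDr.
have [p [hx hy _]] := approx_dsum n0 n0 (GD _ n0 _ xG) (GD _ n0 _ yG) (GD _ nn0 _ zG) e0.
have -> : phi (simil s x) - invmx s *m phi x *m s =
   (phi (simil s x) - peval p (simil s x)) - invmx s *m (phi x - peval p x) *m s.
  by rewrite (peval_simil _ _ su) mulmxBr mulmxBl opprB addrA subrK.
apply: le_trans (opnormD _ _) _; rewrite opnormN mulrDl mul1r; apply: lerD hy _.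
apply: le_trans (opnormM _ _) _; rewrite /c mulrAC; apply: ler_wpM2r => //.
by apply: le_trans (opnormM _ _) _; apply: ler_wpM2l.
Qed.

(** Three basic sets are intersected: one where [p] is close to [phi], one inside [D], and one where
    [p] is bounded; together the first and third bound [phi]. *)
Lemma approx_holomorphic : free_open D -> free_holomorphic D phi.
Proof.
move=> Do n n0 M MD.
have [U [p [Uo [MU [r _ hr]]]]] := approx n0 MD ltr01.
have [a1 [b1 [d1 [M1 G1]]]] := Uo _ n0 _ MU.
have [a2 [b2 [d2 [M2 G2]]]] := Do _ n0 _ MD.
(* The [+ 1] puts [M] strictly inside the set [|p(x)| < t]. *)
pose t := opnorm (peval p M) + 1.
have t0 : 0 < t by rewrite ltr_wpDl.
pose d3 : 'M[fpoly R d]_(1, 1) := const_mx (pscale t^-1%:C%C p).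
pose d23 := block_mx d2 (const_mx [::]) (const_mx [::]) d3.
pose d123 := block_mx d1 (const_mx [::]) (const_mx [::]) d23.
have GD : ncsubset (Gdelta d123) D.
  by move=> k k0 x /Gdelta_block[_ /Gdelta_block[x2 _]]; apply: G2.
exists _, _, d123; split.
  apply/Gdelta_block; split=> //; apply/Gdelta_block; split=> //; apply/Gdelta_poly.
  rewrite peval_scale; apply: le_lt_trans (opnormZ _ _) _.
  by rewrite normcR ?invr_ge0 ?(ltW t0) // mulrC ltr_pdivrMr // mul1r ltrDl.
split=> //; split; first exact: approx_nc.
exists (r + t) => k k0 x xG.
have xD := GD _ k0 _ xG.
move: xG => /Gdelta_block[x1 /Gdelta_block[_ /Gdelta_poly x3]].
rewrite -[phi x](subrK (peval p x)); apply: le_trans (opnormD _ _) _; apply: lerD.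
  by apply: hr => //; apply: G1.
have -> : peval p x = t%:C%C *: peval (pscale t^-1%:C%C p) x.
  by rewrite peval_scale scalerA -rmorphM mulfV ?gt_eqF // scale1r.
apply: le_trans (opnormZ _ _) _; rewrite normcR ?(ltW t0) //.
by rewrite ler_piMr ?(ltW t0) // ltW.
Qed.

End Converse.
End Approximation.

Theorem theorem9p8 (R : realType) (d : nat) (D : ncset R d) (phi : graded_fun R d) :
  free_open D ->
  (free_holomorphic D phi <-> locally_approx_poly D phi).
Proof.
by move=> Do; split=> [|happ]; [apply: holomorphic_approx | apply: approx_holomorphic].
Qed.
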